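(* Fix integers $n,k\geq 2$, and let $P\in \mathbb{R}[X_1,\dots,X_n]$ be a polynomial of degree $k$ with leading form (homogeneous part of degree $k$) $P_k= c_1X_1^k-c_2X_2^k +Q$, where $c_1>0$, $c_2>0$ are real and $Q\in \mathbb{R}[X_3,\dots,X_n]$ is a form of degree $k$. Let $s\in\mathbb{R}$ and suppose there exists a constant $C_s$ such that \[ \Big\|\sup_{0<t<1}|T_t^Pf|\Big\|_{L^1(B_n(0,1))} \leq C_s \|f\|_{H^s(\mathbb{R}^n)}\qquad \text{for all } f\in H^s(\mathbb{R}^n). \] Then $s\geq 1/2$ if $k=2$, and $s\geq 1/3$ if $k\geq 3$.
   Context: A form of degree $e$ is a homogeneous polynomial of degree $e$; the zero polynomial is allowed (in particular $Q=0$ when $n=2$). The Fourier transform is $\hat f(\xi)=\int_{\mathbb{R}^n} f(x)e^{-ix\cdot\xi}\,dx$. For a real polynomial $P$ in $n$ variables, define \[ T_t^{P}f(x) = \frac{1}{(2\pi)^n} \int_{\mathbb{R}^n} \hat{f}(\xi) e^{i(x\cdot \xi + P(\xi)t)}\,d\xi , \] initially for $f$ of Schwartz class on $\mathbb{R}^n$ (and extended to $H^s$ as the Fourier multiplier $e^{iP(\xi)t}$). The Sobolev space $H^s(\mathbb{R}^n)$ consists of all tempered distributions $f$ with finite norm given by $\|f\|_{H^s(\mathbb{R}^n)}^2=(2\pi)^{-n}\int_{\mathbb{R}^n}(1+|\xi|^2)^s|\hat f(\xi)|^2\,d\xi$. $B_n(0,1)$ is the unit ball in $\mathbb{R}^n$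 centered at the origin. *)

(* Defs.v *)
(* R^n is n.-tuple R with R : realType, and C is R[i]. *)
From HB Require Import structures.
From mathcomp Require Import all_boot all_order all_algebra.
From mathcomp Require Import all_classical all_reals all_analysis.
From mathcomp Require Import measurable_realfun complex.
From mathcomp Require mpoly.
Export (canonicals, coercions) mpoly.

Set Implicit Arguments.
Unset Strict Implicit.
Unset Printing Implicit Defensive.

Import Order.TTheory GRing.Theory Num.Theory.
Import numFieldNormedType.Exports.

Local Open Scope classical_set_scope.
Local Open Scope ring_scope.

Section lebesgue_tuple.
Context {R : realType}.
Local Notation E := (measurableTypeR R).

Definition tuple_cons n (p : E * n.-tuple E) : n.+1.-tuple E :=
  [tuple of p.1 :: p.2].

Lemma measurable_tuple_cons n : measurable_fun setT (@tuple_cons n).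
Proof. exact: measurable_cons. Qed.

Section step.
Variables (n : nat) (m : {sigma_finite_measure set (n.-tuple E) -> \bar R}).

Definition lebesgue_step : set (n.+1.-tuple E) -> \bar R :=
  pushforward (@lebesgue_measure R \x m)%E (@tuple_cons n).

HB.instance Definition _ := Measure.copy lebesgue_step
  (measure_function_pushforward__canonical__measure_function_Measure
    (@lebesgue_measure R \x m)%E (@measurable_tuple_cons n)).

Let lebesgue_step_sigma_finite : sigma_finite setT lebesgue_step.
Proof.
have /sigma_finiteP[F [TF ndF Foo]] := sigma_finiteT (@lebesgue_measure R).
have /sigma_finiteP[G [TG ndG Goo]] := sigma_finiteT m.
pose g (x : n.+1.-tuple E) : E * n.-tuple E := (thead x, [tuple of behead x]).
have gK : cancel (@tuple_cons n) g.
  by move=> [a b]; congr pair; apply: val_inj.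
have mg : measurable_fun setT g.
  apply: measurable_fun_pair; last exact: measurable_behead.
  exact: (measurable_tnth ord0).
exists (fun k => g @^-1` (F k `*` G k)).
  apply/esym; rewrite -subTset => x _.
  have [i _ Fi] : (\bigcup_i F i) (g x).1 by rewrite -TF.
  have [j _ Gj] : (\bigcup_i G i) (g x).2 by rewrite -TG.
  exists (maxn i j) => //; split.
    by move: Fi; apply/subsetPset/ndF/leq_maxl.
  by move: Gj; apply/subsetPset/ndG/leq_maxr.
move=> k; have [mF Fk] := Foo k; have [mG Gk] := Goo k; split.
  by rewrite -[X in measurable X]setTI; apply: mg => //; exact: measurableX.
rewrite /lebesgue_step /pushforward -comp_preimage.
rewrite (_ : g \o _ = id); last exact/funext.
by rewrite preimage_id product_measure1E// lte_mul_pinfty// ge0_fin_numE.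
Qed.

HB.instance Definition _ :=
  Measure_isSigmaFinite.Build _ _ _ lebesgue_step lebesgue_step_sigma_finite.

End step.

Fixpoint lebesgue_tuple n : {sigma_finite_measure set (n.-tuple E) -> \bar R} :=
  if n is n'.+1 return {sigma_finite_measure set (n.-tuple E) -> \bar R}
  then lebesgue_step (lebesgue_tuple n') else \d_([tuple] : 0.-tuple E).

Lemma lebesgue_tuple_box n (A : 'I_n -> set E) : (forall i, measurable (A i)) ->
  lebesgue_tuple n [set x | forall i, A i (tnth x i)] =
  (\prod_(i < n) lebesgue_measure (A i))%E.
Proof.
elim: n A => [|n IH] A mA.
  rewrite big_ord0 /= diracE mem_set//.
  by move=> i; case: i.
rewrite big_ord_recl /= -(IH (A \o lift ord0)); last by move=> i; exact: mA.
rewrite -product_measure1E//; last first.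
  rewrite (_ : mkset _ =
      \bigcap_(i in [set: 'I_n]) ((@tnth n E)^~ i @^-1` A (lift ord0 i))).
    apply: fin_bigcap_measurable => // i _.
    by rewrite -[X in measurable X]setTI; exact: measurable_tnth.
  by apply/seteqP; split => [x Ax i _|x Ax i]; exact: Ax.
rewrite /lebesgue_step /pushforward; congr (product_measure1 _ _ _).
apply/seteqP; split => [[a b] /= Ax|[a b] [/= Aa Ab] i].
  split; first exact: (Ax ord0).
  by move=> i; have := Ax (lift ord0 i); rewrite tnthS.
by case: (unliftP ord0 i) => [j ->|->]//; rewrite tnthS; exact: Ab.
Qed.

End lebesgue_tuple.

Section schwartz_sobolev.
Context {R : realType} {n : nat}.
Local Notation C := R[i].
Local Notation E := (n.-tuple (measurableTypeR R)).
Local Notation mu := (@lebesgue_tuple R n).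
Implicit Types (x xi : E) (phi u g : E -> C) (f : (E -> C) -> C).

Definition dotp x xi : R := \sum_(i < n) tnth x i * tnth xi i.
Definition enorm x : R := Num.sqrt (dotp x x).
Definition unit_ball : set E := [set x | enorm x < 1].

Definition expi (a : R) : C := (cos a +i* sin a)%C.

Definition Cmeasurable u :=
  measurable_fun [set: E] (fun x => complex.Re (u x)) /\
  measurable_fun [set: E] (fun x => complex.Im (u x)).
Definition Cintegrable u :=
  mu.-integrable setT (fun x => (complex.Re (u x))%:E) /\
  mu.-integrable setT (fun x => (complex.Im (u x))%:E).
Definition Cintegral u : C :=
  ((\int[mu]_x complex.Re (u x)) +i* (\int[mu]_x complex.Im (u x)))%C.

Definition slice phi (i : 'I_n) x (s : R) : C :=
  phi [tuple if j == i then s else tnth x j | j < n].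
Definition partial_derivable phi (i : 'I_n) x :=
  derivable (fun s : R => complex.Re (slice phi i x s)) (tnth x i) 1 /\
  derivable (fun s : R => complex.Im (slice phi i x s)) (tnth x i) 1.
Definition partial (i : 'I_n) phi x : C :=
  (derive1 (fun s : R => complex.Re (slice phi i x s)) (tnth x i) +i*
   derive1 (fun s : R => complex.Im (slice phi i x s)) (tnth x i))%C.
Definition partials (alpha : seq 'I_n) phi : E -> C := foldr partial phi alpha.

Definition schwartz_term (N : nat) (alpha : seq 'I_n) phi x : R :=
  (1 + enorm x) ^+ N * Normc.normc (partials alpha phi x).

(* Smoothness only asks for the existence of all iterated partial derivatives:
   these are continuous because of the bounds on the next ones. *)
Definition schwartz phi :=
  (forall alpha i x, partial_derivable (partials alpha phi) i x) /\
  (forall N alpha, exists M, forall x, schwartz_term N alpha phi x <= M).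

Definition fourier phi : E -> C :=
  fun xi => Cintegral (fun x => phi x * expi (- dotp x xi)).
Definition inv_fourier phi : E -> C :=
  fun x => (((2 * pi) ^- n)%:C)%C *
           Cintegral (fun xi => phi xi * expi (dotp x xi)).

(* A distribution is a map f : (E -> C) -> C, of which only the values on
   Schwartz functions matter. *)
Definition tempered f :=
  (forall (a : C) phi psi, schwartz phi -> schwartz psi ->
     f (fun x => a * phi x + psi x) = a * f phi + f psi) /\
  (exists N : nat, exists K : R, forall phi, schwartz phi -> forall M : R,
     (forall alpha x, (size alpha <= N)%N -> schwartz_term N alpha phi x <= M) ->
     Normc.normc (f phi) <= K * M).

Definition dist_is_fun f u :=
  Cmeasurable u /\
  forall phi, schwartz phi ->
    Cintegrable (fun x => u x * phi x) /\ f phi = Cintegral (fun x => u x * phi x).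

Definition dist_fourier f : (E -> C) -> C := fun phi => f (fourier phi).
Definition dist_inv_fourier f : (E -> C) -> C := fun phi => f (inv_fourier phi).
Definition dist_mul (m : E -> C) f : (E -> C) -> C :=
  fun phi => f (fun x => m x * phi x).

(* The infimum is over the a.e. unique function g that represents the Fourier
   transform of f; it is +oo when there is none. *)
Definition sobolev_norm (s : R) f : \bar R :=
  ereal_inf [set r | exists2 g, dist_is_fun (dist_fourier f) g &
    r = ((((2 * pi) ^- n)%:E * \int[mu]_xi
           ((1 + enorm xi ^+ 2) `^ s * Normc.normc (g xi) ^+ 2)%:E)
         `^ 2^-1)%E].

Definition sobolev (s : R) f := tempered f /\ (sobolev_norm s f < +oo)%E.

(* T_t^P = F^-1 o (multiplication by e^{iP(xi)t}) o F. When the Fourier transform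
   of f is an integrable function g, it is represented by the function
   x |-> inv_fourier (fun xi => g xi * expi (P(xi) * t)) x. *)
Definition evolution (P : mpoly.mpoly n R) (t : R) f : (E -> C) -> C :=
  dist_inv_fourier
    (dist_mul (fun xi => expi (mpoly.meval (tnth xi) P * t)) (dist_fourier f)).

(* For 0 < t < 1 the functions u t are only determined up to null sets, so the
   supremum over t is taken in the lattice of measurable functions modulo null
   sets: its L^1(D) norm is the least integral of an a.e. majorant. It is the
   norm of the pointwise supremum when u is continuous in t. *)
Definition maximal_L1 (D : set E) (u : R -> E -> C) : \bar R :=
  ereal_inf [set r | exists F : E -> \bar R,
    [/\ measurable_fun [set: E] F, forall x, (0 <= F x)%E,
        forall t, 0 < t < 1 ->
          {ae mu, forall x, D x -> ((Normc.normc (u t x))%:E <= F x)%E} &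
        r = (\int[mu]_(x in D) F x)%E]].

(* The functions u t, unique a.e., are those that represent T_t^P f; they exist
   for every f in H^s when s >= 0. If T_t^P f is not a function for some t, as
   can happen when s < 0, the left-hand side has no meaning and nothing is
   required of f. *)
Definition maximal_estimate (P : mpoly.mpoly n R) (s : R) :=
  exists Cs : R, forall f, sobolev s f ->
    forall u : R -> E -> C,
    (forall t, 0 < t < 1 -> dist_is_fun (evolution P t f) (u t)) ->
    (maximal_L1 unit_ball u <= Cs%:E * sobolev_norm s f)%E.

End schwartz_sobolev.

Section forms.
Context {R : realType}.

Definition mvar {n} (i : 'I_n) : mpoly.mpoly n R := mpoly.mpolyX R (mpoly.mnm1 i).

Definition is_form {n} (d : nat) (Q : mpoly.mpoly n R) : Prop :=
  Q \is mpoly.ishomog1 d (@mpoly.mdeg n).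

Definition homog_part {n} (d : nat) (P : mpoly.mpoly n R) : mpoly.mpoly n R :=
  mpoly.pihomog (@mpoly.mdeg n) d P.

(* Q(X_3, ..., X_n) for n = m.+2, where Q has its m variables numbered from 0. *)
Definition shift2 {m} (Q : mpoly.mpoly m R) : mpoly.mpoly m.+2 R :=
  mpoly.comp_mpoly [tuple mvar (rshift 2 i : 'I_m.+2) | i < m] Q.

End forms.

(* Main.v *)
(* Let kap = sqrt (c1 / c2). At (1, 1) the Hessian of c1 X^k - c2 Y^k vanishes in
   the direction (1, - kap) but the gradient does not. Hence, on the frequencies
   xi = N (1, 1, 0) + y (1, - kap, 0) + eta with |y| <= r L and |eta| <= L, the phase
   x . xi + t P(xi) is, for 0 <= t <= c rho N^(1 - k) and x in a region of size rho,
     phase(x, t) + y (x_1 - kap x_2 + k t N^(k-1) (c1 + c2 kap)) + O(rho)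
   as soon as r^3 <= N^2, which bounds the cubic term in y; if k = 2 there is no
   such term and r = N is allowed. The coefficient of y is cancelled by a suitable
   t = t(x) in (0, 1), so that the maximal function of a packet f of such
   frequencies is at least a constant times the integral of its Fourier transform,
   of order r, on a fixed region, while ||f||_{H^s} is at most of order
   N^max(s, 0) r^(1/2). With N -> oo, r = N or r = N^(2/3) gives the result.

   The Fourier transform of the packet is a product of functions 1 / (1 + s^2). It
   is the transform of an explicit integrable function, a product of exp(- |s|), so
   that the multiplication formula replaces Fourier inversion: only the decay of
   the inverse Fourier transform of a Schwartz function is needed, in order to
   apply Fubini's theorem. *)

Require Import Defs.
From HB Require Import structures.
From mathcomp Require Import all_boot all_order all_algebra.
From mathcomp Require Import all_classical all_reals all_analysis.
From mathcomp Require Import measurable_realfun complex ring lra.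
From mathcomp Require mpoly.

Set Implicit Arguments.
Unset Strict Implicit.
Unset Printing Implicit Defensive.

Import Order.TTheory GRing.Theory Num.Theory.
Import numFieldNormedType.Exports.

Local Open Scope classical_set_scope.
Local Open Scope ring_scope.

(** * Integration along one coordinate *)

Section slices.
Context {R : realType}.
Local Notation E := (measurableTypeR R).
Local Notation leb := (@lebesgue_measure R).
Implicit Types n : nat.

(** The maximal norm sees the times t only through almost everywhere majorants, so the time that
    cancels the coefficient of y has to come from a sequence independent of x. A grid of step of
    order rho / (N^(k-1) r) is fine enough: the coefficient is then at most rho / r, while |y| <= r
    L. The time must also be positive, which is why the region of x lies where x_1 - kap x_2 < 0.
    The value of kap makes c1 - c2 kap^2 vanish, whereas c1 + c2 kap > 0. With t of order rho
    N^(1-k), the cubic term has size t N^(k-3) r^3, that is rho r^3 / N^2, and the part of P of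
    degree below k, of order N^(k-1), contributes O(rho). The estimate bounds r by a multiple of
    N^max(s, 0) r^(1/2), hence r by a multiple of N^(2 max(s, 0)); this is where 1/2 and 1/3 come
    from. The profile 1 / (1 + s^2) decays slowly, but the Sobolev norm contains its square, and the
    spare factor absorbs (1 + |eta|^2)^sg for 0 <= sg <= 1. That range is enough, since the argument
    is by contradiction from s < 1/2 or s < 1/3. *)

Definition upd n (i : 'I_n) (x : n.-tuple E) (s : R) : n.-tuple E :=
  [tuple if j == i then s else tnth x j | j < n].

Lemma tnth_upd n (i : 'I_n) x s j :
  tnth (upd i x s) j = if j == i then s else tnth x j.
Proof. exact: tnth_mktuple. Qed.

Lemma upd_upd n (i : 'I_n) x s t : upd i (upd i x s) t = upd i x t.
Proof.
apply: eq_from_tnth => j; rewrite !tnth_upd.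
by case: ifP => // ji; rewrite ji.
Qed.

Lemma upd_id n (i : 'I_n) x : upd i x (tnth x i) = x.
Proof. by apply: eq_from_tnth => j; rewrite tnth_upd; case: eqP => [->|]. Qed.

Lemma upd_cons0 n (a : E) (b : n.-tuple E) (s : E) :
  upd ord0 (tuple_cons (a, b)) s = tuple_cons (s, b).
Proof.
apply: eq_from_tnth => j; rewrite tnth_upd.
by case: (unliftP ord0 j) => [k ->|->] //; rewrite !tnthS.
Qed.

Lemma upd_consS n (i : 'I_n) (a : E) (b : n.-tuple E) (s : E) :
  upd (lift ord0 i) (tuple_cons (a, b)) s = tuple_cons (a, upd i b s).
Proof.
apply: eq_from_tnth => j; rewrite tnth_upd.
case: (unliftP ord0 j) => [k ->|->] //; rewrite !tnthS tnth_upd.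
by rewrite (inj_eq lift_inj).
Qed.

Lemma ge0_integral_tupleS n (F : n.+1.-tuple E -> \bar R) :
  measurable_fun setT F -> (forall x, 0 <= F x)%E ->
  (\int[lebesgue_tuple n.+1]_x F x =
   \int[leb \x lebesgue_tuple n]_z F (tuple_cons z))%E.
Proof.
move=> mF F0 /=; rewrite /lebesgue_step ge0_integral_pushforward//.
exact: measurable_tuple_cons.
Qed.

Lemma measurable_comp_cons n (F : n.+1.-tuple E -> \bar R) :
  measurable_fun setT F ->
  measurable_fun setT (fun z => F (@tuple_cons R n z)).
Proof. by move=> mF; apply: measurableT_comp => //; exact: measurable_tuple_cons. Qed.

(** Comparing two functions with equal line integrals in direction [i] avoids permuting coordinates
    to bring [i] to the front. Tonelli splits off the first coordinate: if it is the [i]-th, it is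
    integrated first; otherwise it is frozen and the induction hypothesis applies. *)
Lemma ge0_integral_slice n (i : 'I_n) (F H : n.-tuple E -> \bar R) :
  measurable_fun setT F -> (forall x, 0 <= F x)%E ->
  measurable_fun setT H -> (forall x, 0 <= H x)%E ->
  (forall x, \int[leb]_s F (upd i x s) = \int[leb]_s H (upd i x s))%E ->
  (\int[lebesgue_tuple n]_x F x = \int[lebesgue_tuple n]_x H x)%E.
Proof.
elim: n i F H => [[]//|n IH] i F H mF F0 mH H0 FH.
have mF' := measurable_comp_cons mF; have mH' := measurable_comp_cons mH.
rewrite !ge0_integral_tupleS//.
case: (unliftP ord0 i) FH => [j ->|->] FH.
  rewrite !fubini_tonelli1//; apply: eq_integral => a _.
  rewrite /fubini_F; apply: (IH j) => //.
  - exact: (measurableT_comp mF' (measurable_pair1 a)).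
  - exact: (measurableT_comp mH' (measurable_pair1 a)).
  - move=> b /=.
    transitivity (\int[leb]_s F (upd (lift ord0 j) (tuple_cons (a, b)) s))%E.
      by apply: eq_integral => s _; rewrite upd_consS.
    by rewrite FH; apply: eq_integral => s _; rewrite upd_consS.
rewrite !fubini_tonelli2//; apply: eq_integral => b _.
transitivity (\int[leb]_s F (upd ord0 (tuple_cons ((0%R : E), b)) s))%E.
  by apply: eq_integral => s _; rewrite (upd_cons0 (0%R : E)).
by rewrite FH; apply: eq_integral => s _; rewrite (upd_cons0 (0%R : E)).
Qed.

(** The line integrals of [K = F - H] vanish, so those of its positive and negative parts agree and
    the nonnegative case applies to these two parts. *)
Lemma integral_slice n (i : 'I_n) (F H : n.-tuple E -> R) :
  (lebesgue_tuple n).-integrable setT (EFin \o F) ->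
  (lebesgue_tuple n).-integrable setT (EFin \o H) ->
  (forall x, leb.-integrable setT (fun s => (F (upd i x s))%:E)) ->
  (forall x, leb.-integrable setT (fun s => (H (upd i x s))%:E)) ->
  (forall x, \int[leb]_s F (upd i x s) = \int[leb]_s H (upd i x s)) ->
  \int[lebesgue_tuple n]_x F x = \int[lebesgue_tuple n]_x H x.
Proof.
move=> iF iH iFs iHs FH.
have mF := measurable_int _ iF; have mH := measurable_int _ iH.
pose K := fun x => F x - H x.
suff : \int[lebesgue_tuple n]_x K x = 0.
  by rewrite RintegralB// => /eqP; rewrite subr_eq0 => /eqP.
have mK : measurable_fun setT K.
  by apply: measurable_funB; exact/measurable_EFinP.
rewrite /Rintegral integralE.
rewrite (@ge0_integral_slice n i _ (EFin \o K)^\-%E).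
- rewrite -[X in fine X](_ : 0%E = _)//.
  rewrite subee// ge0_fin_numE; last exact: integral_ge0.
  apply: integral_funeneg_lt_pinfty => //.
  by apply: (eq_integrable measurableT) (integrableB measurableT iF iH).
- by apply: measurable_funepos; exact/measurable_EFinP.
- by [].
- by apply: measurable_funeneg; exact/measurable_EFinP.
- by [].
- move=> x.
  have iK : leb.-integrable setT (fun s => (K (upd i x s))%:E).
    exact: (eq_integrable measurableT) (integrableB measurableT (iFs x) (iHs x)).
  have : (\int[leb]_s (K (upd i x s))%:E = 0)%E.
    apply/eqP; rewrite -fine_eq0 ?integrable_fin_num//.
    rewrite -/(Rintegral leb setT (fun s => K (upd i x s))).
    rewrite (RintegralB measurableT (iFs x) (iHs x)).
    by move: (FH x) => /= ->; rewrite subrr.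
  rewrite integralE => /eqP; rewrite sube_eq ?add0e.
  + move/eqP => h; move: h; under eq_integral do rewrite funeposE.
    under [X in _ = X -> _]eq_integral do rewrite funenegE.
    under [X in _ -> X = _]eq_integral do rewrite funeposE.
    by under [X in _ -> _ = X]eq_integral do rewrite funenegE.
  + exact: (integrable_pos_fin_num measurableT iK).
  + rewrite fin_num_adde_defl//.
    exact: (integrable_neg_fin_num measurableT iK).
Qed.

End slices.

(** * Integrals on the line *)

Section line.
Context {R : realType}.
Local Notation E := (measurableTypeR R).
Local Notation leb := (@lebesgue_measure R).

(** By uniqueness of Lebesgue measure: the scaled pushforward has the right value on half-open
    intervals. *)
Lemma lebesgue_measure_affine (a b : R) (A : set R) : 0 < a -> measurable A ->
  leb A = (a%:E * leb ((fun s => a * s + b)%R @^-1` A))%E.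
Proof.
move=> a0 mA.
pose phi : E -> E := fun s => a * s + b.
have mphi : measurable_fun setT phi.
  by apply: measurable_funD => //; exact: measurable_funM.
pose phi_mixin := isMeasurableFun.Build _ _ _ _ _ mphi.
pose phi' : {mfun _ >-> _} := HB.pack phi phi_mixin.
pose a' : {nonneg R} := NngNum (ltW a0).
have -> : (a%:E * leb ((fun s => a * s + b)%R @^-1` A))%E =
    mscale a' (pushforward leb phi') A by [].
apply: lebesgue_measure_unique => //= _ [[x y]] _ <-.
rewrite /mscale /= /mscale /pushforward /=.
have -> : phi @^-1` [set` Interval (BRight x) (BRight y)] =
    [set` Interval (BRight ((x - b) / a)) (BRight ((y - b) / a))].
  apply/seteqP; split => s /=; rewrite !in_itv/= /phi.
  - move=> /andP[xs sy]; rewrite ltr_pdivrMr// ler_pdivlMr//; lra.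
  - by rewrite ltr_pdivrMr// ler_pdivlMr// => /andP[xs sy]; lra.
rewrite !lebesgue_measure_itv/= !lte_fin.
rewrite (_ : ((x - b) / a < (y - b) / a) = (x < y)); last first.
  by rewrite ltr_pM2r ?invr_gt0// ltrBlDr subrK.
case: ifP => _; last by rewrite mule0.
by rewrite -!EFinB -EFinM -mulrBl mulrCA divff ?gt_eqF// mulr1; congr EFin; ring.
Qed.

Lemma ge0_integral_affine (a b : R) (F : E -> \bar R) : 0 < a ->
  measurable_fun setT F -> (forall s, 0 <= F s)%E ->
  (\int[leb]_s F s = a%:E * \int[leb]_s F (a * s + b)%R)%E.
Proof.
move=> a0 mF F0.
pose phi : E -> E := fun s => a * s + b.
have mphi : measurable_fun setT phi.
  by apply: measurable_funD => //; exact: measurable_funM.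
pose phi_mixin := isMeasurableFun.Build _ _ _ _ _ mphi.
pose phi' : {mfun _ >-> _} := HB.pack phi phi_mixin.
pose a' : {nonneg R} := NngNum (ltW a0).
rewrite (@eq_measure_integral _ _ _ setT (mscale a' (pushforward leb phi'))).
  by rewrite ge0_integral_mscale//= ge0_integral_pushforward.
by move=> A mA _; exact: (lebesgue_measure_affine b a0 mA).
Qed.

Lemma ge0_integral_half (F : E -> \bar R) :
  measurable_fun setT F -> (forall s, 0 <= F s)%E ->
  (\int[leb]_s F s =
   \int[leb]_(s in `[0%R, +oo[) F s + \int[leb]_(s in `[0%R, +oo[) F (- s)%R)%E.
Proof.
move=> mF F0.
have mFN : measurable_fun setT (fun s : E => F (- s)%R).
  by apply: (measurableT_comp mF); exact: measurable_funN.
rewrite (ge0_integration_by_substitution0 mFN)//.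
under [X in (_ + X)%E]eq_integral do rewrite opprK.
rewrite -integral_itv_bndo_bndc; last exact: measurable_funTS.
rewrite addeC -ge0_integral_setU//=.
- by rewrite -setCitvl setUv.
- exact: measurable_funTS.
- rewrite disj_set2E; apply/eqP; rewrite -subset0 => x/=.
  by rewrite !in_itv/= andbT ltNge => -[/negP].
Qed.

(** The line is cut at 0 and the negative half reflected, where [- F (- x)] is an antiderivative of
    [f (- x)]; the two values at 0 cancel. *)
Lemma ge0_FTC_line (f F : R -> R) (l l' : R) :
  (forall s, 0 <= f s) -> continuous f ->
  (forall s : R, is_derive s 1 F (f s)) ->
  F x @[x --> +oo] --> l -> F x @[x --> -oo] --> l' ->
  (\int[leb]_s (f s)%:E = (l - l')%:E)%E.
Proof.
move=> f0 cf dF Fl Fl'.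
have cF : continuous F.
  by move=> x; apply/differentiable_continuous/derivable1_diffP; apply: ex_derive.
rewrite ge0_integral_half; last 2 first.
- apply/measurable_EFinP. apply: continuous_measurable_fun. exact: cf.
- by move=> s; rewrite lee_fin.
have -> : (\int[leb]_(s in `[0%R, +oo[) (f s)%:E = l%:E - (F 0)%:E)%E.
  apply: ge0_continuous_FTC2y => //.
  - by apply: continuous_subspaceT.
  - by apply: cvg_at_right_filter; exact: cF.
  - by move=> x _; rewrite derive1E; case: (dF x).
have dG (s : R) : is_derive s 1 (fun x => - F (- x)) (f (- s)).
  have h := @is_deriveN _ _ _ _ _ _ _
    (is_derive1_comp (dF (- s)) (is_deriveN (is_derive_id s 1))).
  by apply: (is_derive_eq h); rewrite /GRing.scale/= mulrN1 opprK.
have -> : (\int[leb]_(s in `[0%R, +oo[) (f (- s))%:E =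
    (- l')%:E - (- F (- 0))%:E)%E.
  apply: (@ge0_continuous_FTC2y _ _ (fun x => - F (- x))) => //.
  - apply: continuous_subspaceT => x.
    by apply: (@continuous_comp _ _ _ -%R f); [exact: oppr_continuous|exact: cf].
  - by apply: cvgN; apply/cvgNy_compNP.
  - apply: cvg_at_right_filter; apply: cvgN.
    by apply: (@continuous_comp _ _ _ -%R F); [exact: oppr_continuous|exact: cF].
  - by move=> x _; rewrite derive1E; case: (dG x).
by rewrite -!EFinB -EFinD; congr EFin; rewrite oppr0; ring.
Qed.

Lemma cvgNy_atan : (@atan R) x @[x --> -oo] --> - (pi / 2).
Proof.
apply/cvgNy_compNP; rewrite (_ : _ \o _ = (fun x => - @atan R x)).
  by apply: cvgN; exact: (@cvgy_atan R).
by apply/funext => x /=; rewrite atanN.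
Qed.

Lemma integral_cauchy : (\int[leb]_s ((oneDsqr s)^-1)%:E = (pi : R)%:E)%E.
Proof.
rewrite (ge0_FTC_line _ _ _ (@cvgy_atan R) cvgNy_atan).
- by congr EFin; field.
- by move=> s; rewrite invr_ge0.
- exact: continuous_oneDsqrV.
Qed.

Lemma integrable_cauchy :
  leb.-integrable setT (fun s => ((oneDsqr s)^-1)%:E).
Proof.
have mc : measurable_fun [set: E] (fun s : R => (oneDsqr s)^-1).
  by apply: continuous_measurable_fun; exact: continuous_oneDsqrV.
apply/integrableP; split; first exact/measurable_EFinP.
have : (\int[leb]_s ((oneDsqr s)^-1)%:E < +oo)%E by rewrite integral_cauchy ltry.
apply: le_lt_trans; rewrite le_eqVlt; apply/orP; left; apply/eqP.
apply: eq_integral => s _; rewrite gee0_abs// lee_fin invr_ge0.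
Qed.

Lemma cvg_oneDsqrV_y : (oneDsqr x)^-1 @[x --> +oo] --> (0 : R).
Proof.
apply: (@squeeze_cvgr _ _ _ _ (cst 0) (fun x : R => x^-1)).
- near=> x; rewrite /= invr_ge0//= lef_pV2 ?posrE//.
  by rewrite /oneDsqr; nra.
- exact: cvg_cst.
- by apply/gtr0_cvgV0; [exact: nbhs_pinfty_gt|exact: cvg_id].
Unshelve. all: by end_near. Qed.

Lemma cvg_oneDsqrV_Ny : (oneDsqr x)^-1 @[x --> -oo] --> (0 : R).
Proof.
apply/cvgNy_compNP; rewrite (_ : _ \o _ = fun x => (oneDsqr x)^-1).
  exact: cvg_oneDsqrV_y.
by apply/funext => x /=; rewrite /oneDsqr sqrrN.
Qed.

Lemma bounded_cvg0 (F : set_system R) (FF : Filter F) (h : R -> R) (C : R) :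
  (forall s, `|h s| <= C / oneDsqr s) ->
  (oneDsqr x)^-1 @[x --> F] --> (0 : R) -> h x @[x --> F] --> (0 : R).
Proof.
move=> hC cv0.
have cvC : C / oneDsqr x @[x --> F] --> (0 : R).
  by rewrite -(mulr0 C); apply: cvgMr.
apply: (@squeeze_cvgr _ _ _ _ (fun x => - (C / oneDsqr x)) (fun x => C / oneDsqr x)) => //.
- by near=> x; rewrite -ler_norml.
- by rewrite -oppr0; apply: cvgN.
Unshelve. all: by end_near. Qed.

(** Adding [C / oneDsqr s] makes the derivative nonnegative, with antiderivative [h + C * atan]. The
    bound on [h] makes it vanish at both ends, so the total is [C * pi], which is exactly the
    integral of the added term. *)
Lemma integral_derivative_eq0 (h h' : R -> R) (C : R) :
  (forall s : R, is_derive s 1 h (h' s)) -> continuous h' ->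
  (forall s, `|h s| <= C / oneDsqr s) -> (forall s, `|h' s| <= C / oneDsqr s) ->
  leb.-integrable setT (EFin \o h') /\ \int[leb]_s h' s = 0.
Proof.
move=> dh ch' hC h'C.
have iC : leb.-integrable setT (fun s => (C / oneDsqr s)%:E).
  apply: (eq_integrable measurableT) (integrableZl measurableT C integrable_cauchy).
  by [].
have ih' : leb.-integrable setT (EFin \o h').
  have mh' : measurable_fun [set: E] h' := continuous_measurable_fun ch'.
  apply: (le_integrable measurableT _ _ iC); first exact/measurable_EFinP.
  by move=> s _ /=; rewrite lee_fin (le_trans (h'C s))// ler_norm.
split=> //.
have : (\int[leb]_s (h' s + C / oneDsqr s)%:E = (C * (pi / 2) - C * - (pi / 2))%:E)%E.
  apply: (@ge0_FTC_line _ (fun s => h s + C * atan s)).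
  - by move=> s; have := h'C s; rewrite ler_norml => /andP[+ _]; rewrite -subr_ge0 opprK.
  - move=> s; apply: cvgD; first exact: ch'.
    by apply: cvgMr; exact: continuous_oneDsqrV.
  - rewrite -[X in _ --> X]add0r; apply: cvgD; last by apply: cvgMr; exact: (@cvgy_atan R).
    exact: bounded_cvg0 hC cvg_oneDsqrV_y.
  - rewrite -[X in _ --> X]add0r; apply: cvgD; last by apply: cvgMr; exact: cvgNy_atan.
    exact: bounded_cvg0 hC cvg_oneDsqrV_Ny.
under eq_integral do rewrite EFinD.
rewrite integralD//.
under [X in (_ + X)%E = _ -> _]eq_integral do rewrite EFinM.
rewrite integralZl//; last exact: integrable_cauchy.
rewrite integral_cauchy /Rintegral -(fineK (integrable_fin_num measurableT ih')).
rewrite -EFinM -EFinD => -[] /=; lra.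
Qed.

End line.

(** * The two-sided exponential and its Fourier transform *)

Section exponential.
Context {R : realType}.
Local Notation E := (measurableTypeR R).
Local Notation leb := (@lebesgue_measure R).

Definition expabs (s : R) : R := expR (- `|s|).

Lemma expabs_gt0 s : 0 < expabs s. Proof. exact: expR_gt0. Qed.

Lemma measurable_expabs : measurable_fun [set: E] expabs.
Proof.
apply: measurableT_comp; first exact: measurable_expR.
by apply: measurable_funN; exact: normr_measurable.
Qed.

Lemma measurable_cosM t : measurable_fun [set: E] (fun s : R => cos (s * t)).
Proof.
apply: measurableT_comp; last exact: measurable_funM.
by apply: continuous_measurable_fun; exact: continuous_cos.
Qed.

Lemma measurable_sinM t : measurable_fun [set: E] (fun s : R => sin (s * t)).
Proof.
apply: measurableT_comp; last exact: measurable_funM.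
by apply: continuous_measurable_fun; exact: continuous_sin.
Qed.

(** The summand 1 makes the integrand nonnegative, so that the fundamental theorem on a half-line
    applies without a separate proof of integrability. *)
Lemma integral_exp_cos_half t :
  (\int[leb]_(s in `[0%R, +oo[) (expR (- s) * (1 + cos (s * t)))%:E =
   (1 + (1 + t ^+ 2)^-1)%:E)%E.
Proof.
have t0 : 1 + t ^+ 2 != 0 by rewrite gt_eqF// ltr_pwDl// sqr_ge0.
(* [expR (- s)] times the fraction is an antiderivative of [expR (- s) * cos (s * t)]; the term - 1
   accounts for [expR (- s)] alone. *)
pose G s := (t * sin (s * t) - cos (s * t)) / (1 + t ^+ 2) - 1.
pose F s := expR (- s) * G s.
have dF (s : R) : is_derive s 1 F (expR (- s) * (1 + cos (s * t))).
  have dE := is_derive1_comp (is_derive_expR (- s)) (is_deriveN (is_derive_id s (1:R))).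
  have dT : is_derive s 1 (fun x : R => x * t) t.
    have h := is_deriveM (is_derive_id s (1:R)) (is_derive_cst t s (1:R)).
    by apply: (is_derive_eq h); rewrite /GRing.scale/=; ring.
  have dS := is_derive1_comp (is_derive_sin ((fun x : R => x * t) s)) dT.
  have dC := is_derive1_comp (is_derive_cos ((fun x : R => x * t) s)) dT.
  have dG := is_deriveB (is_deriveZ (1 + t ^+ 2)^-1
    (is_deriveB (is_deriveZ t dS) dC)) (is_derive_cst (1:R) s (1:R)).
  have h := is_deriveM dE dG.
  have -> : F = (expR \o -%R) *
      ((1 + t ^+ 2)^-1 \*: (t \*: (sin \o *%R^~ t) - (cos \o *%R^~ t)) - cst 1).
    apply/funext => x; rewrite /F /G /=.
    by rewrite !fctE /= /GRing.scale /=; ring.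
  apply: (is_derive_eq h); rewrite /GRing.scale /=.
  rewrite [X in _ + X * _](_ : _ = G s); last by rewrite !fctE /= /GRing.scale /= /G; ring.
  rewrite /G.
  by field.
have cF : continuous F.
  by move=> x; apply/differentiable_continuous/derivable1_diffP; apply: ex_derive.
have Fl : F x @[x --> +oo] --> (0 : R).
  pose K := `|t| + 2.
  have K0 : K * expR (- x) @[x --> +oo] --> (0 : R).
    by rewrite -(mulr0 K); apply: cvgMr; exact: cvgr_expR.
  apply: (@squeeze_cvgr _ _ _ _ (fun x => - (K * expR (- x)))
    (fun x => K * expR (- x))) => //; last by rewrite -oppr0; apply: cvgN.
  apply: nearW => x; rewrite -ler_norml /F normrM mulrC (gtr0_norm (expR_gt0 _)).
  rewrite ler_pM2r ?expR_gt0// /G (le_trans (ler_normB _ _))// normr1.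
  rewrite /K -[2]/(1 + 1) addrA lerD2r normrM.
  rewrite [X in _ * X]gtr0_norm ?invr_gt0 ?ltr_pwDl ?sqr_ge0//.
  rewrite ler_pdivrMr ?ltr_pwDl ?sqr_ge0//.
  apply: (@le_trans _ _ (`|t| + 1)).
    rewrite (le_trans (ler_normB _ _))// normrM lerD//.
      by rewrite ler_piMr// ler_norml sin_geN1 sin_le1.
    by rewrite ler_norml cos_geN1 cos_le1.
  by rewrite ler_peMr ?addr_ge0// lerDl sqr_ge0.
have -> : (1 + (1 + t ^+ 2)^-1)%:E = (0%:E - (F 0)%:E)%E :> \bar R.
  rewrite -EFinB; congr EFin; rewrite /F /G !mul0r oppr0 expR0 sin0 cos0.
  by field.
apply: (@ge0_continuous_FTC2y _ _ F) => //.
- apply: continuous_subspaceT => x; apply: cvgM.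
    apply: (@continuous_comp _ _ _ -%R expR); first exact: oppr_continuous.
    exact: continuous_expR.
  apply: cvgD; first exact: cvg_cst.
  apply: (@continuous_comp _ _ _ (fun y : R => y * t) cos).
    by apply: cvgMl; exact: cvg_id.
  exact: continuous_cos.
- by apply: cvg_at_right_filter; exact: cF.
- by move=> x _; rewrite derive1E; case: (dF x).
Qed.

Lemma integral_expabs_1Dcos t :
  (\int[leb]_s (expabs s * (1 + cos (s * t)))%:E =
   (2 * (1 + (1 + t ^+ 2)^-1))%:E)%E.
Proof.
have mf : measurable_fun [set: E] (fun s : R => expabs s * (1 + cos (s * t))).
  apply: measurable_funM; first exact: measurable_expabs.
  by apply: measurable_funD => //; exact: measurable_cosM.
rewrite ge0_integral_half; last 2 first.
- exact/measurable_EFinP.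
- by move=> s; rewrite lee_fin mulr_ge0// ltW// expabs_gt0.
rewrite mulr_natl mulr2n EFinD -(integral_exp_cos_half t); congr (_ + _)%E.
- apply: eq_integral => s; rewrite inE/= in_itv/= andbT => s0.
  by rewrite /expabs ger0_norm.
- apply: eq_integral => s; rewrite inE/= in_itv/= andbT => s0.
  by rewrite /expabs normrN ger0_norm// mulNr cosN.
Qed.

(** This is the previous formula at [t = 0], where [1 + cos] equals 2; an infinite value would
    contradict it. *)
Lemma integral_expabs : (\int[leb]_s (expabs s)%:E = 2%:E)%E.
Proof.
have h := integral_expabs_1Dcos 0.
have : (2%:E * \int[leb]_s (expabs s)%:E = 4%:E)%E.
  rewrite -ge0_integralZl//.
  - transitivity (2 * (1 + (1 + 0 ^+ 2)^-1) : R)%:E.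
      rewrite -h; apply: eq_integral => s _.
      by rewrite mulr0 cos0 -EFinM mulrC.
    by congr EFin; rewrite expr0n addr0 invr1; ring.
  - by apply/measurable_EFinP; exact: measurable_expabs.
  - by move=> s _; rewrite lee_fin ltW// expabs_gt0.
case: (\int[_]_(_ in _) _)%E => [r [h2]|/=|/=].
- by congr EFin; lra.
- by rewrite gt0_muley// lte_fin.
- by rewrite gt0_muleNy// lte_fin.
Qed.

Lemma integrable_expabs : leb.-integrable setT (EFin \o expabs).
Proof.
apply/integrableP; split; first by apply/measurable_EFinP; exact: measurable_expabs.
have : (\int[leb]_s (expabs s)%:E < +oo)%E by rewrite integral_expabs ltry.
apply: le_lt_trans; rewrite le_eqVlt; apply/orP; left; apply/eqP.
by apply: eq_integral => s _; rewrite gee0_abs// lee_fin ltW// expabs_gt0.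
Qed.

Lemma integrable_expabsM (f : R -> R) : measurable_fun [set: E] f ->
  (forall s, `|f s| <= 1) ->
  leb.-integrable setT (fun s => (expabs s * f s)%:E).
Proof.
move=> mf f1; apply: (le_integrable measurableT _ _ integrable_expabs).
  by apply/measurable_EFinP; apply: measurable_funM => //; exact: measurable_expabs.
move=> s _ /=; rewrite lee_fin normrM ler_piMr//.
Qed.

Lemma cos_norm_le1 (x : R) : `|cos x| <= 1.
Proof. by rewrite ler_norml cos_geN1 cos_le1. Qed.

Lemma sin_norm_le1 (x : R) : `|sin x| <= 1.
Proof. by rewrite ler_norml sin_geN1 sin_le1. Qed.

Lemma integrable_expabs_cos t :
  leb.-integrable setT (fun s => (expabs s * cos (s * t))%:E).
Proof.
apply: integrable_expabsM; first exact: measurable_cosM.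
by move=> s; exact: cos_norm_le1.
Qed.

Lemma integrable_expabs_sin t :
  leb.-integrable setT (fun s => (expabs s * sin (s * t))%:E).
Proof.
apply: integrable_expabsM; first exact: measurable_sinM.
by move=> s; exact: sin_norm_le1.
Qed.

Lemma Rintegral_expabs : \int[leb]_s expabs s = 2.
Proof. by rewrite /Rintegral integral_expabs. Qed.

Lemma Rintegral_expabs_cos t :
  \int[leb]_s (expabs s * cos (s * t)) = 2 / (1 + t ^+ 2).
Proof.
have : \int[leb]_s (expabs s + expabs s * cos (s * t)) = 2 * (1 + (1 + t ^+ 2)^-1).
  have h := integral_expabs_1Dcos t.
  rewrite /Rintegral; under eq_integral do rewrite -[X in X + _]mulr1 -mulrDr.
  by rewrite h.
rewrite RintegralD//; last 2 first.
- exact: integrable_expabs.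
- exact: integrable_expabs_cos.
by rewrite Rintegral_expabs mulrDr mulr1 => /addrI.
Qed.

(** Reflection exchanges the nonnegative functions [expabs s * (1 + sin (s * t))] and
    [expabs s * (1 - sin (s * t))], so their integrals are equal. *)
Lemma Rintegral_expabs_sin t : \int[leb]_s (expabs s * sin (s * t)) = 0.
Proof.
have i1 := integrable_expabs; have i2 := integrable_expabs_sin t.
have m1 := measurable_expabs; have m2 := measurable_sinM t.
have nn s : 0 <= expabs s + expabs s * sin (s * t).
  by rewrite -[X in X + _]mulr1 -mulrDr mulr_ge0// ltW// expabs_gt0.
have nn' s : 0 <= expabs s - expabs s * sin (s * t).
  by rewrite -[X in X - _]mulr1 -mulrBr mulr_ge0// ?subr_ge0 ?sin_le1// ltW// expabs_gt0.
have : \int[leb]_s (expabs s + expabs s * sin (s * t)) =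
    \int[leb]_s (expabs s - expabs s * sin (s * t)).
  rewrite /Rintegral ge0_integral_half; last 2 first.
  - by apply/measurable_EFinP; apply: measurable_funD => //; exact: measurable_funM.
  - by move=> s; rewrite lee_fin.
  rewrite [in RHS]ge0_integral_half; last 2 first.
  - by apply/measurable_EFinP; apply: measurable_funB => //; exact: measurable_funM.
  - by move=> s; rewrite lee_fin.
  rewrite addeC; congr (fine (_ + _)%E); apply: eq_integral => s _.
  - by rewrite /expabs normrN mulNr sinN mulrN.
  - by rewrite /expabs normrN mulNr sinN mulrN opprK.
rewrite RintegralD// RintegralB//; lra.
Qed.

End exponential.

(** * Product functions on tuples *)

Section products.
Context {R : realType}.
Local Notation E := (measurableTypeR R).
Local Notation leb := (@lebesgue_measure R).

Lemma measurable_tuple_prod n (f : R -> R) : measurable_fun [set: E] f ->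
  measurable_fun [set: n.-tuple E] (fun x => \prod_(i < n) f (tnth x i)).
Proof.
move=> mf; apply: measurable_prod => i _.
by apply: (measurableT_comp mf); exact: measurable_tnth.
Qed.

Lemma measurable_linear n (t : 'I_n -> R) :
  measurable_fun [set: n.-tuple E] (fun x => \sum_(i < n) tnth x i * t i).
Proof.
apply: measurable_sum => i; apply: measurable_funM => //.
exact: measurable_tnth.
Qed.

Lemma tuple_prodS n (f : R -> R) (a : E) (b : n.-tuple E) :
  \prod_(i < n.+1) f (tnth (tuple_cons (a, b)) i) =
  f a * \prod_(i < n) f (tnth b i).
Proof. by rewrite big_ord_recl; congr (_ * _); apply: eq_bigr => i _; rewrite tnthS. Qed.

Lemma tuple_sumS n (t : 'I_n.+1 -> R) (a : E) (b : n.-tuple E) :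
  \sum_(i < n.+1) tnth (tuple_cons (a, b)) i * t i =
  a * t ord0 + \sum_(i < n) tnth b i * t (lift ord0 i).
Proof. by rewrite big_ord_recl; congr (_ + _); apply: eq_bigr => i _; rewrite tnthS. Qed.

Lemma ge0_integral_tuple_prod n (f : R -> R) (c : R) :
  measurable_fun [set: E] f -> (forall s, 0 <= f s) ->
  (\int[leb]_s (f s)%:E = c%:E)%E ->
  (\int[lebesgue_tuple n]_x (\prod_(i < n) f (tnth x i))%:E = (c ^+ n)%:E)%E.
Proof.
move=> mf f0 fc.
have pf0 m (x : m.-tuple E) : 0 <= \prod_(i < m) f (tnth x i).
  by apply: prodr_ge0.
elim: n => [|n IH].
  rewrite /= integral_dirac//.
    by rewrite diracE mem_set// mul1e big_ord0 expr0.
  by apply/measurable_EFinP; exact: measurable_tuple_prod.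
have mp : measurable_fun [set: n.+1.-tuple E]
    (fun x => (\prod_(i < n.+1) f (tnth x i))%:E).
  by apply/measurable_EFinP; exact: measurable_tuple_prod.
rewrite ge0_integral_tupleS//; last by move=> x; rewrite lee_fin.
rewrite (fubini_tonelli1 (fun z => (\prod_(i < n.+1) f (tnth (tuple_cons z) i))%:E)).
- rewrite /fubini_F.
  under eq_integral do under eq_integral do rewrite tuple_prodS EFinM.
  under eq_integral => a _.
    rewrite ge0_integralZl//; last 3 first.
    + by apply/measurable_EFinP; exact: measurable_tuple_prod.
    + by move=> x _; rewrite lee_fin.
    + by rewrite lee_fin.
    rewrite IH; over.
  have c0 : (0 <= (c ^+ n)%:E)%E.
    rewrite lee_fin exprn_ge0// -lee_fin -fc.
    by apply: integral_ge0 => s _; rewrite lee_fin.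
  rewrite (ge0_integralZr _ measurableT _ _ c0); last 2 first.
  + by apply/measurable_EFinP.
  + by move=> x _; rewrite lee_fin.
  by rewrite fc -EFinM exprS.
- exact: (measurable_comp_cons mp).
- by move=> x; rewrite lee_fin.
Qed.

Lemma integrable_comp_cons n (F : n.+1.-tuple E -> R) :
  (lebesgue_tuple n.+1).-integrable setT (EFin \o F) ->
  (leb \x lebesgue_tuple n)%E.-integrable setT (fun z => (F (tuple_cons z))%:E).
Proof.
move=> iF; have mF := measurable_int _ iF.
apply/integrableP; split; first exact: (measurable_comp_cons mF).
rewrite -(@ge0_integral_tupleS _ _ (abse \o (EFin \o F)))//.
  by case/integrableP: iF.
  exact: measurableT_comp.
by move=> x; exact: abse_ge0.
Qed.

Lemma integral_tupleS n (F : n.+1.-tuple E -> R) :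
  (lebesgue_tuple n.+1).-integrable setT (EFin \o F) ->
  (forall a : E, (lebesgue_tuple n).-integrable setT
     (fun b => (F (tuple_cons (a, b)))%:E)) ->
  \int[lebesgue_tuple n.+1]_x F x =
  \int[leb]_a \int[lebesgue_tuple n]_b F (tuple_cons (a, b)).
Proof.
move=> iF iFa; have iFc := integrable_comp_cons iF.
have mF := measurable_int _ iF.
rewrite /Rintegral /= /lebesgue_step.
rewrite (integral_pushforward (@measurable_tuple_cons R n) mF)//=.
congr fine; rewrite preimage_setT.
rewrite -(integral12_prod_meas1 iFc); apply: eq_integral => a _.
by rewrite fineK//; exact: integrable_fin_num.
Qed.

(** The exponential of minus the l^1 norm. Taking the l^1 norm makes it a product, whose Fourier
    transform is [2 ^ n] times the function [weight] below. *)
Definition expsum n (x : n.-tuple E) : R := \prod_(i < n) expabs (tnth x i).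

Lemma expsum_gt0 n (x : n.-tuple E) : 0 < expsum x.
Proof. by apply: prodr_gt0 => i _; exact: expabs_gt0. Qed.

Lemma measurable_expsum n : measurable_fun setT (@expsum n).
Proof. by apply: measurable_tuple_prod; exact: measurable_expabs. Qed.

Lemma integrable_expsum n :
  (lebesgue_tuple n).-integrable setT (EFin \o @expsum n).
Proof.
apply/integrableP; split.
  by apply/measurable_EFinP; exact: measurable_expsum.
have h := @ge0_integral_tuple_prod n _ _ measurable_expabs
  (fun s => ltW (expabs_gt0 s)) (@integral_expabs R).
have : (\int[lebesgue_tuple n]_x (expsum x)%:E < +oo)%E by rewrite h ltry.
apply: le_lt_trans; rewrite le_eqVlt; apply/orP; left; apply/eqP.
by apply: eq_integral => s _; rewrite gee0_abs// lee_fin ltW// expsum_gt0.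
Qed.

Lemma integrable_expsumM n (f : n.-tuple E -> R) : measurable_fun setT f ->
  (forall x, `|f x| <= 1) ->
  (lebesgue_tuple n).-integrable setT (fun x => (expsum x * f x)%:E).
Proof.
move=> mf f1; apply: (le_integrable measurableT _ _ (integrable_expsum n)).
  by apply/measurable_EFinP; apply: measurable_funM => //; exact: measurable_expsum.
by move=> x _ /=; rewrite lee_fin normrM ler_piMr.
Qed.

Lemma measurable_cos_linear n (t : 'I_n -> R) :
  measurable_fun [set: n.-tuple E] (fun x => cos (\sum_(i < n) tnth x i * t i)).
Proof.
apply: (measurableT_comp (f := @cos R)); last exact: measurable_linear.
by apply: continuous_measurable_fun; exact: continuous_cos.
Qed.

Lemma measurable_sin_linear n (t : 'I_n -> R) :
  measurable_fun [set: n.-tuple E] (fun x => sin (\sum_(i < n) tnth x i * t i)).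
Proof.
apply: (measurableT_comp (f := @sin R)); last exact: measurable_linear.
by apply: continuous_measurable_fun; exact: continuous_sin.
Qed.

Lemma integrable_expsum_cos n (t : 'I_n -> R) : (lebesgue_tuple n).-integrable setT
  (fun x => (expsum x * cos (\sum_(i < n) tnth x i * t i))%:E).
Proof.
apply: integrable_expsumM; first exact: measurable_cos_linear.
by move=> x; exact: cos_norm_le1.
Qed.

Lemma integrable_expsum_sin n (t : 'I_n -> R) : (lebesgue_tuple n).-integrable setT
  (fun x => (expsum x * sin (\sum_(i < n) tnth x i * t i))%:E).
Proof.
apply: integrable_expsumM; first exact: measurable_sin_linear.
by move=> x; exact: sin_norm_le1.
Qed.

(** The real and imaginary parts are computed together because the addition formulas mix them in the
    induction on [n]. In each formula the terms with a sine in the remaining coordinates integrate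
    to 0. *)
Lemma Rintegral_expsum_cos_sin n (t : 'I_n -> R) :
  \int[lebesgue_tuple n]_x (expsum x * cos (\sum_(i < n) tnth x i * t i)) =
    \prod_(i < n) (2 / (1 + t i ^+ 2)) /\
  \int[lebesgue_tuple n]_x (expsum x * sin (\sum_(i < n) tnth x i * t i)) = 0.
Proof.
elim: n t => [|n IH] t.
  have mc := measurable_cos_linear t; have ms := measurable_sin_linear t.
  have me := measurable_expsum (n := 0).
  rewrite big_ord0 /Rintegral /=; split; rewrite integral_dirac//.
  - by rewrite diracE mem_set// mul1e /expsum !big_ord0 cos0 mulr1.
  - by apply/measurable_EFinP; exact: measurable_funM.
  - by rewrite diracE mem_set// mul1e /expsum !big_ord0 sin0 mulr0.
  - by apply/measurable_EFinP; exact: measurable_funM.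
have [IHc IHs] := IH (fun i => t (lift ord0 i)).
have icn := integrable_expsum_cos (fun i => t (lift ord0 i)).
have isn := integrable_expsum_sin (fun i => t (lift ord0 i)).
pose S (b : n.-tuple E) := \sum_(i < n) tnth b i * t (lift ord0 i).
have Ec (a : E) (b : n.-tuple E) : expsum (tuple_cons (a, b)) *
    cos (\sum_(i < n.+1) tnth (tuple_cons (a, b)) i * t i) =
    (expabs a * cos (a * t ord0)) * (expsum b * cos (S b)) -
    (expabs a * sin (a * t ord0)) * (expsum b * sin (S b)).
  by rewrite /expsum tuple_prodS tuple_sumS cosD /S; ring.
have Es (a : E) (b : n.-tuple E) : expsum (tuple_cons (a, b)) *
    sin (\sum_(i < n.+1) tnth (tuple_cons (a, b)) i * t i) =
    (expabs a * sin (a * t ord0)) * (expsum b * cos (S b)) +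
    (expabs a * cos (a * t ord0)) * (expsum b * sin (S b)).
  by rewrite /expsum tuple_prodS tuple_sumS sinD /S; ring.
have iZ (c : R) (f : n.-tuple E -> R) :
    (lebesgue_tuple n).-integrable setT (EFin \o f) ->
    (lebesgue_tuple n).-integrable setT (fun b => (c * f b)%:E).
  by move=> /(integrableZl measurableT c); apply: eq_integrable.
split.
- rewrite integral_tupleS; first last.
  + move=> a; under eq_fun do rewrite Ec EFinB.
    by apply: integrableB => //; exact: iZ.
  + exact: integrable_expsum_cos.
  under eq_Rintegral do under eq_Rintegral do rewrite Ec.
  under eq_Rintegral => a _.
    rewrite RintegralB//; [|exact: iZ|exact: iZ].
    rewrite !RintegralZl// IHc IHs mulr0 subr0 mulrC; over.
  rewrite RintegralZl//; last exact: integrable_expabs_cos.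
  by rewrite Rintegral_expabs_cos big_ord_recl mulrC.
- rewrite integral_tupleS; first last.
  + move=> a; under eq_fun do rewrite Es EFinD.
    by apply: integrableD => //; exact: iZ.
  + exact: integrable_expsum_sin.
  under eq_Rintegral do under eq_Rintegral do rewrite Es.
  under eq_Rintegral => a _.
    rewrite RintegralD//; [|exact: iZ|exact: iZ].
    rewrite !RintegralZl// IHc IHs mulr0 addr0 mulrC; over.
  rewrite RintegralZl//; last exact: integrable_expabs_sin.
  by rewrite Rintegral_expabs_sin mulr0.
Qed.

Definition weight n (x : n.-tuple E) : R := \prod_(i < n) (oneDsqr (tnth x i))^-1.

Lemma oneDsqrV_gt0 (s : R) : 0 < (oneDsqr s)^-1.
Proof. by rewrite invr_gt0. Qed.

Lemma weight_gt0 n (x : n.-tuple E) : 0 < weight x.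
Proof. by apply: prodr_gt0 => i _; exact: oneDsqrV_gt0. Qed.

Lemma measurable_oneDsqrV : measurable_fun [set: E] (fun s : R => (oneDsqr s)^-1).
Proof. by apply: continuous_measurable_fun; exact: continuous_oneDsqrV. Qed.

Lemma measurable_weight n : measurable_fun setT (@weight n).
Proof. exact: (measurable_tuple_prod measurable_oneDsqrV). Qed.

Lemma integral_weight n :
  (\int[lebesgue_tuple n]_x (weight x)%:E = (pi ^+ n)%:E)%E.
Proof.
exact: (ge0_integral_tuple_prod n measurable_oneDsqrV
  (fun s => ltW (oneDsqrV_gt0 s)) (@integral_cauchy R)).
Qed.

Lemma integrable_weight n :
  (lebesgue_tuple n).-integrable setT (EFin \o @weight n).
Proof.
apply/integrableP; split.
  by apply/measurable_EFinP; exact: measurable_weight.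
have : (\int[lebesgue_tuple n]_x (weight x)%:E < +oo)%E by rewrite integral_weight ltry.
apply: le_lt_trans; rewrite le_eqVlt; apply/orP; left; apply/eqP.
by apply: eq_integral => s _; rewrite gee0_abs// lee_fin ltW// weight_gt0.
Qed.

Lemma weight_le n (x : n.-tuple E) i : weight x <= (oneDsqr (tnth x i))^-1.
Proof.
rewrite /weight (bigD1 i)//=.
apply: ler_piMr; first exact: ltW (oneDsqrV_gt0 _).
apply: prodr_ile1 => j _; rewrite (ltW (oneDsqrV_gt0 _))/=.
exact: oneDsqrV_le1.
Qed.

End products.

(** * Changes of variables and measurability *)

Section changes.
Context {R : realType}.
Local Notation E := (measurableTypeR R).
Local Notation leb := (@lebesgue_measure R).

(** When [b] does not depend on the [i]-th coordinate, this map has Jacobian [a]. The linear changes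
    of variables of the packet, on both the frequency and the physical side, are built from such
    maps, so no general Jacobian formula is involved. *)
Definition shear n (i : 'I_n) (a : R) (b : n.-tuple E -> R) (x : n.-tuple E) :=
  upd i x (a * tnth x i + b x).

Lemma measurable_upd n (i : 'I_n) (h : n.-tuple E -> R) :
  measurable_fun setT h -> measurable_fun setT (fun x => upd i x (h x)).
Proof.
move=> mh; apply/measurable_fun_tnthP => j.
rewrite (_ : _ \o _ = fun x => if j == i then h x else tnth x j); last first.
  by apply/funext => x; rewrite /= tnth_upd.
by case: (j == i) => //; exact: measurable_tnth.
Qed.

Lemma measurable_shear n (i : 'I_n) (a : R) b :
  measurable_fun setT b -> measurable_fun setT (@shear n i a b).
Proof.
move=> mb; apply: measurable_upd; apply: measurable_funD => //.
by apply: measurable_funM => //; exact: measurable_tnth.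
Qed.

(** On each line in direction [i] the function [b] is constant, so the map is affine there and the
    two line integrals agree. *)
Lemma ge0_integral_shear n (i : 'I_n) (a : R) (b : n.-tuple E -> R)
    (F : n.-tuple E -> \bar R) :
  0 < a -> measurable_fun setT b -> (forall x s, b (upd i x s) = b x) ->
  measurable_fun setT F -> (forall x, 0 <= F x)%E ->
  (\int[lebesgue_tuple n]_x F x =
   a%:E * \int[lebesgue_tuple n]_x F (shear i a b x))%E.
Proof.
move=> a0 mb bi mF F0.
have mS := measurable_shear i a mb.
have mFS : measurable_fun setT (fun x => F (shear i a b x)).
  exact: (measurableT_comp mF mS).
rewrite -ge0_integralZl//; last by rewrite lee_fin ltW.
apply: (@ge0_integral_slice _ _ i) => //.
- exact: measurable_funeM.
- by move=> x; rewrite mule_ge0// lee_fin ltW.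
move=> x.
have mu : measurable_fun [set: E] (fun s : E => upd i x s).
  apply/measurable_fun_tnthP => j.
  rewrite (_ : _ \o _ = fun s : E => if j == i then s else tnth x j); last first.
    by apply/funext => s; rewrite /= tnth_upd.
  by case: (j == i).
rewrite (ge0_integral_affine (b x) a0 (measurableT_comp mF mu)); last first.
  by move=> s; exact: F0.
have mA : measurable_fun [set: E] (fun s : E => F (upd i x (a * s + b x))).
  apply: (measurableT_comp mF); apply: (measurableT_comp mu).
  by apply: measurable_funD => //; exact: measurable_funM.
rewrite -(ge0_integralZl _ measurableT mA)//; last by rewrite lee_fin ltW.
by apply: eq_integral => s _; rewrite /shear bi upd_upd tnth_upd eqxx.
Qed.

Lemma integrable_shear n (i : 'I_n) (a : R) (b : n.-tuple E -> R)
    (F : n.-tuple E -> R) :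
  0 < a -> measurable_fun setT b -> (forall x s, b (upd i x s) = b x) ->
  measurable_fun setT F ->
  (lebesgue_tuple n).-integrable setT (fun x => (F (shear i a b x))%:E) ->
  (lebesgue_tuple n).-integrable setT (EFin \o F).
Proof.
move=> a0 mb bi mF /integrableP[_ iF].
apply/integrableP; split; first exact/measurable_EFinP.
rewrite (ge0_integral_shear a0 mb bi)//.
- by rewrite lte_mul_pinfty// lee_fin ltW.
- by apply: measurableT_comp => //; exact/measurable_EFinP.
Qed.

Lemma Rintegral_shear n (i : 'I_n) (a : R) (b : n.-tuple E -> R)
    (F : n.-tuple E -> R) :
  0 < a -> measurable_fun setT b -> (forall x s, b (upd i x s) = b x) ->
  measurable_fun setT F ->
  (lebesgue_tuple n).-integrable setT (fun x => (F (shear i a b x))%:E) ->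
  \int[lebesgue_tuple n]_x F x = a * \int[lebesgue_tuple n]_x F (shear i a b x).
Proof.
move=> a0 mb bi mF iF.
rewrite /Rintegral integralE.
have mEF : measurable_fun setT (EFin \o F) by exact/measurable_EFinP.
rewrite (ge0_integral_shear a0 mb bi (measurable_funepos mEF))//.
rewrite (ge0_integral_shear a0 mb bi (measurable_funeneg mEF))//.
rewrite [in RHS]integralE.
have e1 : (\int[lebesgue_tuple n]_x (EFin \o F)^\+ (shear i a b x) =
  \int[lebesgue_tuple n]_x (fun y => (F (shear i a b y))%:E)^\+ x)%E.
  by apply: eq_integral => x _; rewrite !funeposE.
have e2 : (\int[lebesgue_tuple n]_x (EFin \o F)^\- (shear i a b x) =
  \int[lebesgue_tuple n]_x (fun y => (F (shear i a b y))%:E)^\- x)%E.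
  by apply: eq_integral => x _; rewrite !funenegE.
rewrite e1 e2.
have f1 := integrable_pos_fin_num measurableT iF.
have f2 := integrable_neg_fin_num measurableT iF.
by rewrite -(fineK f1) -(fineK f2) -!EFinM -!EFinB /= mulrBr.
Qed.

(** Schwartz functions are given by their partial derivatives, hence are continuous in each variable
    separately. Rounding the first coordinate gives functions that, on each of countably many slabs,
    depend on the other coordinates only and are measurable by induction; continuity in the first
    coordinate makes them converge pointwise to [f]. *)
Lemma measurable_separately_continuous n (f : n.-tuple E -> R) :
  (forall i x, continuous (fun s : R => f (upd i x s))) ->
  measurable_fun setT f.
Proof.
elim: n f => [|n IH] f cf.
  by rewrite (_ : f = cst (f [tuple]))//; apply/funext => x; rewrite (tuple0 x).
(* Rounding down to a multiple of 1 / (k + 1). *)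
pose d (k : nat) (a : R) : R := (Num.floor (k.+1%:R * a))%:~R / k.+1%:R.
pose tl (x : n.+1.-tuple E) : n.-tuple E := [tuple of behead x].
pose F k (x : n.+1.-tuple E) := f (tuple_cons (d k (tnth x ord0), tl x)).
have consE x : tuple_cons (tnth x ord0, tl x) = x.
  by rewrite {3}(tuple_eta x); apply: val_inj.
apply: (measurable_fun_cvg (h := F)).
- move=> k _ Y mY; rewrite setTI.
  pose G (z : int) : set (n.+1.-tuple E) :=
    [set x | Num.floor (k.+1%:R * tnth x ord0) = z] `&`
    [set x | Y (f (tuple_cons ((z%:~R / k.+1%:R : E), tl x)))].
  rewrite (_ : _ @^-1` _ = \bigcup_z G z); last first.
    apply/seteqP; split => [x /= Yx|x [z _ [/= zE]]].
      by exists (Num.floor (k.+1%:R * tnth x ord0)).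
    by rewrite -zE.
  apply: countable_bigcupT_measurable => [|z].
    exact: countableP.
  apply: measurableI.
    rewrite (_ : mkset _ =
        (fun x : n.+1.-tuple E => k.+1%:R * tnth x ord0) @^-1`
          `[z%:~R, (z + 1)%:~R[%classic).
      rewrite -[X in measurable X]setTI.
      have mk : measurable_fun setT (fun x : n.+1.-tuple E => k.+1%:R * tnth x ord0 : R).
        by apply: measurable_funM => //; exact: measurable_tnth.
      exact: mk.
    apply/seteqP; split => x /=; rewrite in_itv/=.
      by move=> <-; exact: floor_itv.
    by move/floor_def.
  have mfz : measurable_fun setT
      (fun b : n.-tuple E => f (tuple_cons ((z%:~R / k.+1%:R : E), b))).
    apply: IH => i b.
    have := cf (lift ord0 i) (tuple_cons ((z%:~R / k.+1%:R : E), b)).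
    by under eq_fun do rewrite upd_consS.
  rewrite -[X in measurable X]setTI.
  exact: (measurableT_comp mfz (@measurable_behead _ _ n)).
- move=> x _; rewrite /F.
  have cfx : f (upd ord0 x s) @[s --> (tnth x ord0 : R)] --> f (upd ord0 x (tnth x ord0)).
    exact: cf.
  rewrite upd_id in cfx.
  have dx : d k (tnth x ord0) @[k --> \oo] --> tnth x ord0.
    apply: (@squeeze_cvgr _ _ _ _ (fun k => tnth x ord0 - harmonic k) (cst (tnth x ord0))).
    + near=> k; rewrite /d /=.
      have k0 : 0 < k.+1%:R :> R by rewrite ltr0n.
      have /andP[h1 h2] := floor_itv (k.+1%:R * tnth x ord0).
      rewrite ler_pdivrMr// ler_pdivlMr// mulrBl mulVf ?gt_eqF//.
      rewrite intrD mulr1z in h2.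
      by rewrite [tnth x ord0 * _]mulrC; apply/andP; split; lra.
    + rewrite -[X in _ --> X]subr0; apply: cvgB; first exact: cvg_cst.
      exact: cvg_harmonic.
    + exact: cvg_cst.
  have := cvg_comp _ _ dx cfx.
  apply: cvg_trans; apply: near_eq_cvg; near=> k => /=.
  by rewrite -{1}(consE x) upd_cons0.
Unshelve. all: by end_near. Qed.

End changes.

(** * Complex-valued functions *)

Section complex_facts.
Context {R : realType}.
Local Notation C := R[i].
Implicit Types z w : C.

Lemma ReM z w : complex.Re (z * w) =
  complex.Re z * complex.Re w - complex.Im z * complex.Im w.
Proof. by case: z w => a b [c d]. Qed.

Lemma ImM z w : complex.Im (z * w) =
  complex.Re z * complex.Im w + complex.Im z * complex.Re w.
Proof. by case: z w => a b [c d]. Qed.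

Lemma ReD z w : complex.Re (z + w) = complex.Re z + complex.Re w.
Proof. by case: z w => a b [c d]. Qed.

Lemma ImD z w : complex.Im (z + w) = complex.Im z + complex.Im w.
Proof. by case: z w => a b [c d]. Qed.

Lemma normcE z : Normc.normc z = Num.sqrt (complex.Re z ^+ 2 + complex.Im z ^+ 2).
Proof. by case: z. Qed.

Lemma normc_ge0 z : 0 <= Normc.normc z.
Proof. by rewrite normcE sqrtr_ge0. Qed.

Lemma sqr_normc z : Normc.normc z ^+ 2 = complex.Re z ^+ 2 + complex.Im z ^+ 2.
Proof. by rewrite normcE sqr_sqrtr// addr_ge0// sqr_ge0. Qed.

Lemma Re_le_normc z : `|complex.Re z| <= Normc.normc z.
Proof.
rewrite -(@ler_pXn2r _ 2) ?nnegrE ?normc_ge0//.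
by rewrite real_normK ?num_real// sqr_normc lerDl sqr_ge0.
Qed.

Lemma Im_le_normc z : `|complex.Im z| <= Normc.normc z.
Proof.
rewrite -(@ler_pXn2r _ 2) ?nnegrE ?normc_ge0//.
by rewrite real_normK ?num_real// sqr_normc lerDr sqr_ge0.
Qed.

Lemma normc_le_ReIm z : Normc.normc z <= `|complex.Re z| + `|complex.Im z|.
Proof.
rewrite -(@ler_pXn2r _ 2) ?nnegrE ?normc_ge0 ?addr_ge0//.
rewrite sqr_normc sqrrD !real_normK ?num_real//.
by rewrite -addrA lerD2l lerDr mulrn_wge0// mulr_ge0.
Qed.

Lemma normc_expi (a : R) : Normc.normc (expi a) = 1.
Proof. by rewrite normcE /= cos2Dsin2 sqrtr1. Qed.

Lemma expiD (a b : R) : expi (a + b) = expi a * expi b.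
Proof.
apply/eqP; rewrite eq_complex ReM ImM /= cosD sinD eqxx /=; apply/eqP; ring.
Qed.

(** The left-hand side is the real part of [expi (- a) * z]. It bounds an oscillatory integral from
    below once its phase is known to be close to [a]. *)
Lemma rotate_le_normc (a : R) z :
  cos a * complex.Re z + sin a * complex.Im z <= Normc.normc z.
Proof.
have -> : cos a * complex.Re z + sin a * complex.Im z = complex.Re (expi (- a) * z).
  by rewrite ReM /= cosN sinN; ring.
rewrite (le_trans (ler_norm _))// (le_trans (Re_le_normc _))//.
by rewrite Normc.normcM normc_expi mul1r.
Qed.

Lemma normc_real (a : R) : Normc.normc (a%:C)%C = `|a|.
Proof. by rewrite normcE /= expr0n addr0 sqrtr_sqr. Qed.

End complex_facts.

Section complex_measurable.
Context {R : realType} {d} {T : measurableType d}.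
Local Notation C := R[i].
Implicit Types u v : T -> C.

(** The condition [Cmeasurable] on an arbitrary measurable space: kernels are functions on the
    product [E * E]. *)
Definition cmeasurable u :=
  measurable_fun [set: T] (fun x => complex.Re (u x)) /\
  measurable_fun [set: T] (fun x => complex.Im (u x)).

Lemma cmeasurableM u v :
  cmeasurable u -> cmeasurable v -> cmeasurable (fun x => u x * v x).
Proof.
move=> [mu1 mu2] [mv1 mv2]; split.
- under eq_fun do rewrite ReM.
  by apply: measurable_funB; apply: measurable_funM.
- under eq_fun do rewrite ImM.
  by apply: measurable_funD; apply: measurable_funM.
Qed.

Lemma cmeasurable_cst (c : C) : cmeasurable (fun=> c).
Proof. by split; exact: measurable_cst. Qed.

Lemma cmeasurable_expi (f : T -> R) : measurable_fun setT f ->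
  cmeasurable (fun x => expi (f x)).
Proof.
move=> mf; split.
- apply: (measurableT_comp (f := @cos R)) => //.
  by apply: continuous_measurable_fun; exact: continuous_cos.
- apply: (measurableT_comp (f := @sin R)) => //.
  by apply: continuous_measurable_fun; exact: continuous_sin.
Qed.

Lemma cmeasurable_real (f : T -> R) : measurable_fun setT f ->
  cmeasurable (fun x => ((f x)%:C)%C).
Proof. by move=> mf; split => //; exact: measurable_cst. Qed.

Lemma measurable_normc u : cmeasurable u ->
  measurable_fun setT (fun x => Normc.normc (u x)).
Proof.
move=> [mu1 mu2]; under eq_fun do rewrite normcE.
apply: (measurableT_comp (f := @Num.sqrt R)).
  by apply: continuous_measurable_fun; exact: sqrt_continuous.
by apply: measurable_funD; exact: measurable_funX.
Qed.

End complex_measurable.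

Lemma cmeasurable_comp {R : realType} {d d'} {T : measurableType d}
    {T' : measurableType d'} (f : T -> T') (u : T' -> R[i]) :
  measurable_fun setT f -> cmeasurable u -> cmeasurable (fun x => u (f x)).
Proof.
move=> mf [mu1 mu2]; split.
- exact: (measurableT_comp mu1 mf).
- exact: (measurableT_comp mu2 mf).
Qed.

Section parametric.
Context {R : realType} {d d'} {T : measurableType d} {T' : measurableType d'}.
Variable mu : {sigma_finite_measure set T' -> \bar R}.

Lemma measurable_Rintegral_param (f : T * T' -> R) :
  measurable_fun setT f ->
  measurable_fun setT (fun x => \int[mu]_y f (x, y)).
Proof.
move=> mf; rewrite /Rintegral.
apply: (measurableT_comp (f := @fine R)); first exact: fine_measurable.
have mEf : measurable_fun setT (EFin \o f) by exact/measurable_EFinP.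
rewrite (_ : (fun x => _) = fun x =>
    (\int[mu]_y (EFin \o f)^\+ (x, y) - \int[mu]_y (EFin \o f)^\- (x, y))%E); last first.
  apply/funext => x; rewrite integralE; congr (_ - _)%E; apply: eq_integral => y _.
  - by rewrite !funeposE.
  - by rewrite !funenegE.
apply: emeasurable_funB.
- apply: (measurable_fun_fubini_tonelli_F (EFin \o f)^\+%E) => //.
  exact: measurable_funepos.
- apply: (measurable_fun_fubini_tonelli_F (EFin \o f)^\-%E) => //.
  exact: measurable_funeneg.
Qed.

End parametric.

(** * Complex integrals and the multiplication formulas *)

Section cintegral.
Context {R : realType} {n : nat}.
Local Notation C := R[i].
Local Notation E := (n.-tuple (measurableTypeR R)).
Local Notation mu := (@lebesgue_tuple R n).
Implicit Types (u v a b : E -> C).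

Lemma Cintegrable_le u (A : E -> R) : Cmeasurable u ->
  mu.-integrable setT (EFin \o A) -> (forall x, Normc.normc (u x) <= A x) ->
  Cintegrable u.
Proof.
move=> [m1 m2] iA uA; split; apply: (le_integrable measurableT _ _ iA).
- exact/measurable_EFinP.
- move=> x _ /=; rewrite lee_fin (le_trans (Re_le_normc _))//.
  by rewrite (le_trans (uA x))// ler_norm.
- exact/measurable_EFinP.
- move=> x _ /=; rewrite lee_fin (le_trans (Im_le_normc _))//.
  by rewrite (le_trans (uA x))// ler_norm.
Qed.

Lemma Cintegrable_measurable u : Cintegrable u -> Cmeasurable u.
Proof.
move=> [i1 i2]; split; apply/measurable_EFinP.
- exact: measurable_int i1.
- exact: measurable_int i2.
Qed.

Lemma integrable_normc u : Cintegrable u ->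
  mu.-integrable setT (fun x => (Normc.normc (u x))%:E).
Proof.
move=> iu; have mu' := Cintegrable_measurable iu.
case: iu => i1 i2.
have iS := integrableD measurableT (integrable_abse i1) (integrable_abse i2).
apply: (le_integrable measurableT _ _ iS).
  by apply/measurable_EFinP; exact: measurable_normc.
move=> x _ /=; rewrite lee_fin ger0_norm ?normc_ge0//.
by rewrite (le_trans (normc_le_ReIm _))// ler_norm.
Qed.

Lemma CintegrableM_le u v (M : R) : Cintegrable u -> Cmeasurable v ->
  (forall x, Normc.normc (v x) <= M) -> Cintegrable (fun x => u x * v x).
Proof.
move=> iu mv vM; have iN := integrable_normc iu.
apply: (@Cintegrable_le _ (fun x => M * Normc.normc (u x))).
- by apply: cmeasurableM => //; exact: Cintegrable_measurable.
- by have := integrableZl measurableT M iN; apply: eq_integrable.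
- by move=> x; rewrite Normc.normcM mulrC ler_wpM2r// normc_ge0.
Qed.

Lemma CintegrableMl_le u v (M : R) : Cintegrable u -> Cmeasurable v ->
  (forall x, Normc.normc (v x) <= M) -> Cintegrable (fun x => v x * u x).
Proof.
by move=> iu mv vM; under eq_fun do rewrite mulrC; exact: CintegrableM_le vM.
Qed.

Lemma CintegrableZ (c : C) u : Cintegrable u -> Cintegrable (fun x => c * u x).
Proof.
by move=> iu; apply: (@CintegrableMl_le _ (fun=> c) (Normc.normc c)) => //.
Qed.

Lemma CintegralZ (c : C) u : Cintegrable u ->
  Cintegral (fun x => c * u x) = c * Cintegral u.
Proof.
move=> [i1 i2]; have iZ (r : R) (f : E -> R) : mu.-integrable setT (EFin \o f) ->
    mu.-integrable setT (fun x => (r * f x)%:E).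
  by move=> /(integrableZl measurableT r); apply: eq_integrable.
rewrite /Cintegral; apply/eqP; rewrite eq_complex ReM ImM /=; apply/andP; split.
- under eq_Rintegral do rewrite ReM.
  by rewrite RintegralB ?RintegralZl//; exact: iZ.
- under eq_Rintegral do rewrite ImM.
  by rewrite RintegralD ?RintegralZl//; exact: iZ.
Qed.

Lemma CintegralD u v : Cintegrable u -> Cintegrable v ->
  Cintegral (fun x => u x + v x) = Cintegral u + Cintegral v.
Proof.
move=> [iu1 iu2] [iv1 iv2].
rewrite /Cintegral; apply/eqP; rewrite eq_complex ReD ImD /=; apply/andP; split.
- by under eq_Rintegral do rewrite ReD; rewrite RintegralD.
- by under eq_Rintegral do rewrite ImD; rewrite RintegralD.
Qed.

Lemma eq_Cintegral u v : u =1 v -> Cintegral u = Cintegral v.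
Proof. by move=> uv; congr Cintegral; exact/funext. Qed.

(** The factor 2 comes from bounding the real and imaginary parts separately; constants are
    irrelevant where this is used. *)
Lemma normc_Cintegral_le u : Cintegrable u ->
  Normc.normc (Cintegral u) <= 2 * \int[mu]_x Normc.normc (u x).
Proof.
move=> iu; have iN := integrable_normc iu; case: (iu) => i1 i2.
have i1' := integrable_norm i1; have i2' := integrable_norm i2.
rewrite (le_trans (normc_le_ReIm _))// mulr_natl mulr2n lerD//=.
- rewrite (le_trans (le_normr_Rintegral measurableT i1))//.
  by apply: le_Rintegral => // x _; exact: Re_le_normc.
- rewrite (le_trans (le_normr_Rintegral measurableT i2))//.
  by apply: le_Rintegral => // x _; exact: Im_le_normc.
Qed.

Lemma Rintegral_swap (f : E * E -> R) :
  (mu \x mu)%E.-integrable setT (EFin \o f) ->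
  (forall x, mu.-integrable setT (fun y => (f (x, y))%:E)) ->
  (forall y, mu.-integrable setT (fun x => (f (x, y))%:E)) ->
  \int[mu]_x \int[mu]_y f (x, y) = \int[mu]_y \int[mu]_x f (x, y).
Proof.
move=> iF ix iy; rewrite /Rintegral; apply: (f_equal (@fine R)).
transitivity (\int[mu]_x \int[mu]_y (f (x, y))%:E)%E.
  (* Every slice is integrable, not just almost every one, so [fine] loses nothing in the inner
     integrals. *)
  by apply: eq_integral => x _; rewrite fineK//; exact: integrable_fin_num.
rewrite (Fubini iF); apply: eq_integral => y _.
by rewrite fineK//; exact: integrable_fin_num.
Qed.

Section kernel.
Variable K : E -> E -> C.
Hypothesis mK : cmeasurable (fun z : E * E => K z.1 z.2).
Hypothesis K1 : forall x y, Normc.normc (K x y) <= 1.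

Lemma kernel_measurable x : Cmeasurable (K x).
Proof. exact: (cmeasurable_comp (pair1_measurable x) mK). Qed.

Lemma kernel_measurable2 y : Cmeasurable (K^~ y).
Proof. exact: (cmeasurable_comp (pair2_measurable y) mK). Qed.

Lemma Cmeasurable_transform b : Cmeasurable b ->
  Cmeasurable (fun x => Cintegral (fun y => b y * K x y)).
Proof.
move=> mb.
have [m1 m2] : cmeasurable (fun z : E * E => b z.2 * K z.1 z.2).
  by apply: cmeasurableM => //; exact: (cmeasurable_comp measurable_snd mb).
split.
- exact: (measurable_Rintegral_param mu m1).
- exact: (measurable_Rintegral_param mu m2).
Qed.

Lemma normc_transform_le b x : Cintegrable b ->
  Normc.normc (Cintegral (fun y => b y * K x y)) <=
  2 * \int[mu]_y Normc.normc (b y).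
Proof.
move=> ib.
have ibK : Cintegrable (fun y => b y * K x y).
  exact: (CintegrableM_le ib (kernel_measurable x) (K1 x)).
rewrite (le_trans (normc_Cintegral_le ibK))// ler_wpM2l//.
apply: le_Rintegral => //; [exact: integrable_normc|exact: integrable_normc|].
by move=> y _; rewrite Normc.normcM ler_piMr// normc_ge0.
Qed.

Lemma integrable_tensor a b : Cintegrable a -> Cintegrable b ->
  (mu \x mu)%E.-integrable setT
    (fun z => (Normc.normc (a z.1) * Normc.normc (b z.2))%:E).
Proof.
move=> ia ib; have mca := measurable_normc (Cintegrable_measurable ia).
have mcb := measurable_normc (Cintegrable_measurable ib).
have mab : measurable_fun setT (fun z : E * E => Normc.normc (a z.1) * Normc.normc (b z.2)).
  by apply: measurable_funM; [exact: (measurableT_comp mca)|exact: (measurableT_comp mcb)].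
apply/integrable12ltyP; first exact/measurable_EFinP.
have iNa := integrable_normc ia; have iNb := integrable_normc ib.
have B0 : (0 <= \int[mu]_y (Normc.normc (b y))%:E)%E.
  by apply: integral_ge0 => y _; rewrite lee_fin normc_ge0.
rewrite (_ : (\int[mu]_x _)%E =
    (\int[mu]_x ((Normc.normc (a x))%:E * \int[mu]_y (Normc.normc (b y))%:E))%E); last first.
  apply: eq_integral => x _; rewrite -ge0_integralZl//.
  - by apply: eq_integral => y _; rewrite gee0_abs ?lee_fin ?mulr_ge0 ?normc_ge0// EFinM.
  - exact/measurable_EFinP.
  - by move=> y _; rewrite lee_fin normc_ge0.
  - by rewrite lee_fin normc_ge0.
rewrite ge0_integralZr//; last 2 first.
- exact/measurable_EFinP.
- by move=> y _; rewrite lee_fin normc_ge0.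
have A0 : (0 <= \int[mu]_y (Normc.normc (a y))%:E)%E.
  by apply: integral_ge0 => y _; rewrite lee_fin normc_ge0.
have fA := integrable_fin_num measurableT iNa.
have fB := integrable_fin_num measurableT iNb.
by rewrite ltey_eq fin_numM.
Qed.

(** A kernel bounded by 1 leaves the integrand dominated by the tensor product of [a] and [b], which
    is integrable. The statement is kept for a general kernel to cover both signs in the
    exponential. *)
Lemma Cfubini a b : Cintegrable a -> Cintegrable b ->
  Cintegral (fun x => a x * Cintegral (fun y => b y * K x y)) =
  Cintegral (fun y => b y * Cintegral (fun x => a x * K x y)).
Proof.
move=> ia ib.
have ma := Cintegrable_measurable ia; have mb := Cintegrable_measurable ib.
pose U (z : E * E) := a z.1 * (b z.2 * K z.1 z.2).
have [mU1 mU2] : cmeasurable U.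
  apply: cmeasurableM; first exact: (cmeasurable_comp measurable_fst ma).
  by apply: cmeasurableM => //; exact: (cmeasurable_comp measurable_snd mb).
have iT := integrable_tensor ia ib.
have UT z : Normc.normc (U z) <= Normc.normc (a z.1) * Normc.normc (b z.2).
  by rewrite /U !Normc.normcM ler_wpM2l ?normc_ge0// ler_piMr ?normc_ge0.
have iU1 : (mu \x mu)%E.-integrable setT (fun z => (complex.Re (U z))%:E).
  apply: (le_integrable measurableT _ _ iT); first exact/measurable_EFinP.
  move=> z _ /=; rewrite lee_fin (le_trans (Re_le_normc _))//.
  by rewrite (le_trans (UT z))// ler_norm.
have iU2 : (mu \x mu)%E.-integrable setT (fun z => (complex.Im (U z))%:E).
  apply: (le_integrable measurableT _ _ iT); first exact/measurable_EFinP.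
  move=> z _ /=; rewrite lee_fin (le_trans (Im_le_normc _))//.
  by rewrite (le_trans (UT z))// ler_norm.
have ibK x : Cintegrable (fun y => b y * K x y).
  exact: (CintegrableM_le ib (kernel_measurable x) (K1 x)).
have iaK y : Cintegrable (fun x => a x * K x y).
  exact: (CintegrableM_le ia (kernel_measurable2 y) (K1^~ y)).
transitivity (Cintegral (fun x => Cintegral (fun y => U (x, y)))).
  by apply: eq_Cintegral => x; rewrite -CintegralZ.
transitivity (Cintegral (fun y => Cintegral (fun x => U (x, y)))); last first.
  apply: eq_Cintegral => y; rewrite -CintegralZ//; apply: eq_Cintegral => x.
  by rewrite /U /= mulrCA.
have iUx x : Cintegrable (fun y => U (x, y)) by exact: (CintegrableZ (a x) (ibK x)).
have iUy y : Cintegrable (fun x => U (x, y)).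
  by rewrite /U /=; under eq_fun do rewrite mulrCA; exact: (CintegrableZ (b y) (iaK y)).
apply: (f_equal2 (@Complex R)).
- apply: (Rintegral_swap (f := fun z => complex.Re (U z))) => // [x|y].
  + by case: (iUx x).
  + by case: (iUy y).
- apply: (Rintegral_swap (f := fun z => complex.Im (U z))) => // [x|y].
  + by case: (iUx x).
  + by case: (iUy y).
Qed.

End kernel.

Lemma dotpC (x y : E) : dotp x y = dotp y x.
Proof. by apply: eq_bigr => i _; rewrite mulrC. Qed.

Lemma measurable_dotp : measurable_fun setT (fun z : E * E => dotp z.1 z.2).
Proof.
apply: measurable_sum => i; apply: measurable_funM.
- exact: (measurableT_comp (measurable_tnth i) measurable_fst).
- exact: (measurableT_comp (measurable_tnth i) measurable_snd).
Qed.

Lemma cmeasurable_expi_dotp : cmeasurable (fun z : E * E => expi (dotp z.1 z.2)).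
Proof. exact: cmeasurable_expi measurable_dotp. Qed.

Lemma cmeasurable_expi_dotpN :
  cmeasurable (fun z : E * E => expi (- dotp z.1 z.2)).
Proof. by apply: cmeasurable_expi; apply: measurable_funN; exact: measurable_dotp. Qed.

Lemma normc_expi_le1 (f : E -> E -> R) x y : Normc.normc (expi (f x y)) <= 1.
Proof. by rewrite normc_expi. Qed.

(** Fubini with a kernel symmetric in its two arguments. *)
Lemma fourier_mult a b : Cintegrable a -> Cintegrable b ->
  Cintegral (fun x => a x * fourier b x) = Cintegral (fun x => b x * fourier a x).
Proof.
move=> ia ib.
rewrite -(@Cfubini (fun x y => expi (- dotp x y)) cmeasurable_expi_dotpN
  (normc_expi_le1 (fun x y => - dotp x y)) _ _ ia ib).
apply: eq_Cintegral => x; congr (_ * _); apply: eq_Cintegral => y.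
by rewrite dotpC.
Qed.

Lemma Cintegral_expi_dotp_integrable a x : Cintegrable a ->
  Cintegrable (fun y => a y * expi (dotp x y)).
Proof.
move=> ia; apply: (CintegrableM_le ia
  (kernel_measurable (K := fun x y => expi (dotp x y)) cmeasurable_expi_dotp x)).
by move=> y; rewrite normc_expi.
Qed.

Lemma Cmeasurable_inv_fourier a : Cintegrable a -> Cmeasurable (inv_fourier a).
Proof.
move=> ia; apply: cmeasurableM; first exact: cmeasurable_cst.
exact: (Cmeasurable_transform (K := fun x y => expi (dotp x y))
  cmeasurable_expi_dotp (Cintegrable_measurable ia)).
Qed.

Lemma inv_fourier_bounded a : Cintegrable a ->
  exists M, forall x, Normc.normc (inv_fourier a x) <= M.
Proof.
move=> ia.
exists (Normc.normc (((2 * pi) ^- n)%:C : C)%C * (2 * \int[mu]_y Normc.normc (a y))).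
move=> x; rewrite Normc.normcM ler_wpM2l ?normc_ge0//.
exact: (normc_transform_le (K := fun x y => expi (dotp x y))
  cmeasurable_expi_dotp (normc_expi_le1 (@dotp R n)) x ia).
Qed.

Lemma inv_fourier_mult a b : Cintegrable a -> Cintegrable b ->
  Cintegral (fun x => a x * inv_fourier b x) =
  Cintegral (fun x => b x * inv_fourier a x).
Proof.
move=> ia ib.
have iT u v : Cintegrable u -> Cintegrable v ->
    Cintegrable (fun x => u x * Cintegral (fun y => v y * expi (dotp x y))).
  move=> iu iv; apply: (CintegrableM_le iu).
    exact: (Cmeasurable_transform (K := fun x y => expi (dotp x y))
      cmeasurable_expi_dotp (Cintegrable_measurable iv)).
  by move=> x; exact: (normc_transform_le (K := fun x y => expi (dotp x y))
    cmeasurable_expi_dotp (normc_expi_le1 (@dotp R n)) x iv).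
rewrite /inv_fourier.
under eq_Cintegral do rewrite mulrCA.
rewrite CintegralZ; last exact: iT.
under [RHS]eq_Cintegral do rewrite mulrCA.
rewrite CintegralZ; last exact: iT.
apply: (f_equal ( *%R (((2 * pi) ^- n)%:C : C)%C)).
rewrite (@Cfubini (fun x y => expi (dotp x y)) cmeasurable_expi_dotp
  (normc_expi_le1 (@dotp R n)) _ _ ia ib).
apply: eq_Cintegral => x; congr (_ * _); apply: eq_Cintegral => y.
by rewrite dotpC.
Qed.

End cintegral.

(** * Schwartz functions *)

Section schwartz_facts.
Context {R : realType} {n : nat}.
Local Notation C := R[i].
Local Notation E := (n.-tuple (measurableTypeR R)).
Local Notation mu := (@lebesgue_tuple R n).
Implicit Types (phi : E -> C) (x y : E).

Lemma slice_upd phi (i : 'I_n) x (s : R) : slice phi i (upd i x s) = slice phi i x.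
Proof. by apply/funext => t; rewrite /slice -!/(upd _ _ _) upd_upd. Qed.

Lemma schwartz_is_derive phi (i : 'I_n) x (s : R) : schwartz phi ->
  is_derive s 1 (fun t : R => complex.Re (phi (upd i x t)))
    (complex.Re (partial i phi (upd i x s))) /\
  is_derive s 1 (fun t : R => complex.Im (phi (upd i x t)))
    (complex.Im (partial i phi (upd i x s))).
Proof.
move=> [dphi _]; have := dphi [::] i (upd i x s).
rewrite /partial_derivable /partial /= slice_upd tnth_upd eqxx => -[d1 d2].
split; rewrite derive1E.
- exact: (DeriveDef d1 erefl).
- exact: (DeriveDef d2 erefl).
Qed.

Lemma schwartz_partial phi (i : 'I_n) : schwartz phi -> schwartz (partial i phi).
Proof.
move=> [d b].
have E1 alpha : partials alpha (partial i phi) = partials (rcons alpha i) phi.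
  by rewrite /partials foldr_rcons.
split=> [alpha j x|N alpha].
- by rewrite E1; exact: d.
- by have [M hM] := b N (rcons alpha i); exists M => x; rewrite /schwartz_term E1; exact: hM.
Qed.

Lemma schwartz_slice_continuous phi (i : 'I_n) x : schwartz phi ->
  continuous (fun t : R => complex.Re (phi (upd i x t))) /\
  continuous (fun t : R => complex.Im (phi (upd i x t))).
Proof.
move=> sphi; split=> s; apply/differentiable_continuous/derivable1_diffP;
  have [d1 d2] := schwartz_is_derive i x s sphi; exact: ex_derive.
Qed.

Lemma schwartz_measurable phi : schwartz phi -> Cmeasurable phi.
Proof.
move=> sphi; split; apply: measurable_separately_continuous => i x.
- by have [] := schwartz_slice_continuous i x sphi.
- by have [] := schwartz_slice_continuous i x sphi.
Qed.

Lemma sqr_tnth_le_dotp x (i : 'I_n) : tnth x i ^+ 2 <= dotp x x.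
Proof.
rewrite /dotp (bigD1 i)//= expr2 lerDl sumr_ge0// => j _.
by rewrite -expr2 sqr_ge0.
Qed.

Lemma dotp_ge0 x : 0 <= dotp x x.
Proof. by apply: sumr_ge0 => j _; rewrite -expr2 sqr_ge0. Qed.

Lemma enorm_ge0 x : 0 <= enorm x. Proof. exact: sqrtr_ge0. Qed.

(** Each factor satisfies 1 + x_i^2 <= (1 + |x|)^2. This turns the seminorm of order [2 * n] of a
    Schwartz function into a bound by the integrable product [weight]. *)
Lemma weight_enorm_ge1 x : 1 <= (1 + enorm x) ^+ (2 * n) * weight x.
Proof.
rewrite exprM /weight -{2}(card_ord n) -prodr_const -big_split/=.
apply: (@le_trans _ _ (\prod_(i < n) 1)); first by rewrite big1.
apply: ler_prod => i _; rewrite ler01/= ler_pdivlMr// mul1r.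
rewrite /oneDsqr sqrrD expr1n -addrA lerD2l (le_trans (sqr_tnth_le_dotp x i))//.
by rewrite sqr_sqrtr ?dotp_ge0// lerDr mulrn_wge0// mul1r enorm_ge0.
Qed.

Lemma schwartz_le_weight phi : schwartz phi ->
  exists2 M, 0 <= M & forall x, Normc.normc (phi x) <= M * weight x.
Proof.
move=> [_ b]; have [M hM] := b (2 * n)%N [::].
have M0 : 0 <= M.
  apply: le_trans (hM [tuple (0 : R) | i < n]); rewrite /schwartz_term.
  by rewrite mulr_ge0 ?normc_ge0// exprn_ge0// addr_ge0// enorm_ge0.
exists M => // x.
apply: (@le_trans _ _ (((1 + enorm x) ^+ (2 * n) * weight x) * Normc.normc (phi x))).
  by rewrite ler_peMl ?normc_ge0// weight_enorm_ge1.
by rewrite mulrAC ler_wpM2r ?(ltW (weight_gt0 _))//; exact: hM.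
Qed.

Lemma Cintegrable_le_weight (u : E -> C) (M : R) : Cmeasurable u ->
  (forall x, Normc.normc (u x) <= M * weight x) -> Cintegrable u.
Proof.
move=> mu' uM; apply: (Cintegrable_le mu' _ uM).
by have := integrableZl measurableT M (@integrable_weight R n); apply: eq_integrable.
Qed.

Lemma schwartz_integrable phi : schwartz phi -> Cintegrable phi.
Proof.
move=> sphi; have [M _ hM] := schwartz_le_weight sphi.
exact: (Cintegrable_le_weight (schwartz_measurable sphi) hM).
Qed.

Lemma schwartz_bounded phi : schwartz phi ->
  exists M, forall x, Normc.normc (phi x) <= M.
Proof.
move=> [_ b]; have [M hM] := b 0 [::]; exists M => x.
by have := hM x; rewrite /schwartz_term expr0 mul1r.
Qed.

Lemma dotp_upd x y (i : 'I_n) (s : R) :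
  dotp x (upd i y s) = tnth x i * s + \sum_(j < n | j != i) tnth x j * tnth y j.
Proof.
rewrite /dotp (bigD1 i)//= tnth_upd eqxx; congr (_ + _).
by apply: eq_bigr => j /negbTE ji; rewrite tnth_upd ji.
Qed.

Lemma is_derive_dotp x y (i : 'I_n) (s : R) :
  is_derive s 1 (fun t : R => dotp x (upd i y t)) (tnth x i).
Proof.
under eq_fun do rewrite dotp_upd.
have h := is_deriveD (is_deriveZ (tnth x i) (is_derive_id s (1 : R)))
  (is_derive_cst (\sum_(j < n | j != i) tnth x j * tnth y j) s (1 : R)).
by apply: (is_derive_eq h); rewrite /GRing.scale/= mulr1 addr0.
Qed.

(** * Integration by parts against a character *)

Section by_parts.
Variables (phi : E -> C) (i : 'I_n) (x : E).
Hypothesis sphi : schwartz phi.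

Let e y : C := expi (dotp x y).

(* [is_derive_Re] and [is_derive_Im] are used below as type class instances. *)
Let is_derive_Re y (s : R) :
  is_derive s 1 (fun t : R => complex.Re (phi (upd i y t) * e (upd i y t)))
    (complex.Re (partial i phi (upd i y s) * e (upd i y s)) -
     tnth x i * complex.Im (phi (upd i y s) * e (upd i y s))).
Proof.
have [d1 d2] := schwartz_is_derive i y s sphi.
have dd := is_derive_dotp x y i s.
have dc := is_derive1_comp (is_derive_cos ((fun t : R => dotp x (upd i y t)) s)) dd.
have ds := is_derive1_comp (is_derive_sin ((fun t : R => dotp x (upd i y t)) s)) dd.
have h := is_deriveB (is_deriveM d1 dc) (is_deriveM d2 ds).
under eq_fun do rewrite ReM.
by apply: (is_derive_eq h); rewrite ReM ImM /GRing.scale /=; ring.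
Qed.

Let is_derive_Im y (s : R) :
  is_derive s 1 (fun t : R => complex.Im (phi (upd i y t) * e (upd i y t)))
    (complex.Im (partial i phi (upd i y s) * e (upd i y s)) +
     tnth x i * complex.Re (phi (upd i y s) * e (upd i y s))).
Proof.
have [d1 d2] := schwartz_is_derive i y s sphi.
have dd := is_derive_dotp x y i s.
have dc := is_derive1_comp (is_derive_cos ((fun t : R => dotp x (upd i y t)) s)) dd.
have ds := is_derive1_comp (is_derive_sin ((fun t : R => dotp x (upd i y t)) s)) dd.
have h := is_deriveD (is_deriveM d1 ds) (is_deriveM d2 dc).
under eq_fun do rewrite ImM.
by apply: (is_derive_eq h); rewrite ReM ImM /GRing.scale /=; ring.
Qed.

Let continuous_e y :
  continuous (fun s : R => cos (dotp x (upd i y s))) /\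
  continuous (fun s : R => sin (dotp x (upd i y s))).
Proof.
have cd : continuous (fun s : R => dotp x (upd i y s)).
  move=> s; apply/differentiable_continuous/derivable1_diffP.
  by have d := is_derive_dotp x y i s; exact: ex_derive.
split=> s.
- by apply: (@continuous_comp _ _ _ (fun s : R => dotp x (upd i y s)) cos);
    [exact: cd|exact: continuous_cos].
- by apply: (@continuous_comp _ _ _ (fun s : R => dotp x (upd i y s)) sin);
    [exact: cd|exact: continuous_sin].
Qed.

Let continuous_slice (psi : E -> C) y : schwartz psi ->
  continuous (fun s : R => complex.Re (psi (upd i y s) * e (upd i y s))) /\
  continuous (fun s : R => complex.Im (psi (upd i y s) * e (upd i y s))).
Proof.
move=> spsi; have [c1 c2] := schwartz_slice_continuous i y spsi.
have [cc cs] := continuous_e y.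
split=> s.
- under eq_fun do rewrite ReM.
  by apply: cvgB; apply: cvgM; [exact: c1|exact: cc|exact: c2|exact: cs].
- under eq_fun do rewrite ImM.
  by apply: cvgD; apply: cvgM; [exact: c1|exact: cs|exact: c2|exact: cc].
Qed.

Let normc_e (psi : E -> C) y : Normc.normc (psi y * e y) = Normc.normc (psi y).
Proof. by rewrite Normc.normcM normc_expi mulr1. Qed.

(** [D] is the derivative of [F] in direction [i], and [weight] restricted to a line in this
    direction is at most the Cauchy function of the moving coordinate. So every line integral of [D]
    vanishes, and [D] is compared with the zero function. *)
Let integral_total_derivative (F D : E -> R) (M : R) :
  mu.-integrable setT (EFin \o D) ->
  (forall y (s : R), is_derive s 1 (fun t : R => F (upd i y t)) (D (upd i y s))) ->
  (forall y, continuous (fun s : R => D (upd i y s))) ->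
  0 <= M ->
  (forall y, `|F y| <= M * weight y) -> (forall y, `|D y| <= M * weight y) ->
  \int[mu]_y D y = 0.
Proof.
move=> iD dF cD M0 FM DM.
have wM y s : M * weight (upd i y s) <= M / oneDsqr s.
  rewrite ler_wpM2l//; have := weight_le (upd i y s) i.
  by rewrite tnth_upd eqxx.
have h y := integral_derivative_eq0 (dF y) (cD y)
  (fun s => le_trans (FM _) (wM y s)) (fun s => le_trans (DM _) (wM y s)).
rewrite (integral_slice (i := i) iD (H := cst 0)).
- by rewrite Rintegral_cst// mul0r.
- exact: integrable0.
- by move=> y; have [] := h y.
- by move=> y; exact: integrable0.
- by move=> y; have [_ ->] := h y; rewrite Rintegral_cst// mul0r.
Qed.

(** The right-hand side is [- i x_i] times the transform of [phi], written in components. Each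
    component expresses that the derivative in direction [i] of the real or imaginary part of
    [phi * e] has integral 0. *)
Lemma transform_partial :
  Cintegral (fun y => partial i phi y * e y) =
  (tnth x i * complex.Im (Cintegral (fun y => phi y * e y)) +i*
   (- (tnth x i * complex.Re (Cintegral (fun y => phi y * e y)))))%C.
Proof.
have sp := schwartz_partial i sphi.
have [M0 M00 hM0] := schwartz_le_weight sphi.
have [M1 M10 hM1] := schwartz_le_weight sp.
(* One constant for both the product and its derivative, whose second term carries the factor
   [tnth x i]. *)
pose M := M0 + M1 + `|tnth x i| * M0.
have Mx : 0 <= `|tnth x i| * M0 by rewrite mulr_ge0.
have M_0 : 0 <= M by rewrite !addr_ge0.
have [i1 i2] := Cintegral_expi_dotp_integrable x (schwartz_integrable sphi).
have [j1 j2] := Cintegral_expi_dotp_integrable x (schwartz_integrable sp).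
have b1 y : Normc.normc (phi y * e y) <= M * weight y.
  rewrite normc_e (le_trans (hM0 y))// ler_wpM2r ?(ltW (weight_gt0 _))//.
  by rewrite /M -addrA lerDl addr_ge0.
have b2 y : Normc.normc (partial i phi y * e y) +
    `|tnth x i| * Normc.normc (phi y * e y) <= M * weight y.
  rewrite !normc_e /M mulrDl lerD//.
    rewrite (le_trans (hM1 y))// ler_wpM2r ?(ltW (weight_gt0 _))//.
    by rewrite lerDr.
  by rewrite -mulrA ler_wpM2l.
have iZ (r : R) (f : E -> R) : mu.-integrable setT (EFin \o f) ->
    mu.-integrable setT (fun x => (r * f x)%:E).
  by move=> /(integrableZl measurableT r); apply: eq_integrable.
have eRe : \int[mu]_y complex.Re (partial i phi y * e y) =
    tnth x i * \int[mu]_y complex.Im (phi y * e y).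
  apply/eqP.
  rewrite -RintegralZl// -subr_eq0 -RintegralB//; last exact: iZ.
  apply/eqP; apply: (integral_total_derivative (M := M)
    (F := fun y => complex.Re (phi y * e y))) => //.
  + by apply: (eq_integrable measurableT) (integrableB measurableT j1 (iZ _ _ i2)).
  + move=> y s; apply: cvgB; first by have [c _] := continuous_slice y sp; exact: c.
    by apply: cvgMr; have [_ c] := continuous_slice y sphi; exact: c.
  + by move=> y; rewrite (le_trans (Re_le_normc _)).
  + move=> y; apply: le_trans (b2 y); rewrite (le_trans (ler_normB _ _))//.
    by apply: lerD; [exact: Re_le_normc|rewrite normrM ler_wpM2l// Im_le_normc].
have eIm : \int[mu]_y complex.Im (partial i phi y * e y) =
    - (tnth x i * \int[mu]_y complex.Re (phi y * e y)).
  apply/eqP.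
  rewrite -RintegralZl// -addr_eq0 -RintegralD//; last exact: iZ.
  apply/eqP; apply: (integral_total_derivative (M := M)
    (F := fun y => complex.Im (phi y * e y))) => //.
  + by apply: (eq_integrable measurableT) (integrableD measurableT j2 (iZ _ _ i1)).
  + move=> y s; apply: cvgD; first by have [_ c] := continuous_slice y sp; exact: c.
    by apply: cvgMr; have [c _] := continuous_slice y sphi; exact: c.
  + by move=> y; rewrite (le_trans (Im_le_normc _)).
  + move=> y; apply: le_trans (b2 y); rewrite (le_trans (ler_normD _ _))//.
    by apply: lerD; [exact: Im_le_normc|rewrite normrM ler_wpM2l// Re_le_normc].
exact: (f_equal2 (@Complex R) eRe eIm).
Qed.

Lemma normc_transform_partial :
  Normc.normc (Cintegral (fun y => partial i phi y * e y)) =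
  `|tnth x i| * Normc.normc (Cintegral (fun y => phi y * e y)).
Proof.
rewrite transform_partial !normcE /= sqrrN !exprMn -mulrDr sqrtrM ?sqr_ge0//.
by rewrite sqrtr_sqr addrC.
Qed.

End by_parts.

(** Two derivatives in direction [i] multiply the modulus of the transform by x_i^2, so the bounds
    for [phi] and for its second derivative add up to the factor 1 + x_i^2. The induction is over
    all Schwartz functions for this reason. *)
Lemma transform_decay phi (L : seq 'I_n) : schwartz phi ->
  exists M, forall x, Normc.normc (Cintegral (fun y => phi y * expi (dotp x y))) *
    \prod_(i <- L) oneDsqr (tnth x i) <= M.
Proof.
elim: L phi => [|i L IH] phi sphi.
  have iphi := schwartz_integrable sphi.
  exists (2 * \int[mu]_y Normc.normc (phi y)) => x; rewrite big_nil mulr1.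
  exact: (normc_transform_le (K := fun x y => expi (dotp x y))
    cmeasurable_expi_dotp (normc_expi_le1 (@dotp R n)) x iphi).
have s1 := schwartz_partial i sphi; have s2 := schwartz_partial i s1.
have [M1 h1] := IH _ sphi; have [M2 h2] := IH _ s2.
exists (M1 + M2) => x; rewrite big_cons mulrA.
have := lerD (h1 x) (h2 x).
rewrite (normc_transform_partial i x s1) (normc_transform_partial i x sphi).
apply: le_trans; rewrite -mulrDl mulrA -expr2 real_normK ?num_real//.
by rewrite ler_wpM2r ?prodr_ge0// /oneDsqr mulrDr mulr1 [X in _ + X]mulrC.
Qed.

Lemma inv_fourier_integrable phi : schwartz phi -> Cintegrable (inv_fourier phi).
Proof.
move=> sphi; have [M hM] := transform_decay (enum 'I_n) sphi.
pose c : R := Normc.normc (((2 * pi) ^- n)%:C : C)%C.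
apply: (@Cintegrable_le_weight _ (c * M)).
  exact: (Cmeasurable_inv_fourier (schwartz_integrable sphi)).
move=> x; rewrite Normc.normcM -mulrA ler_wpM2l ?normc_ge0//.
have := hM x; rewrite big_enum /= -ler_pdivlMr; last by apply: prodr_gt0.
by rewrite /weight prodfV.
Qed.

End schwartz_facts.

(** * Distributions given by integrable functions *)

Section distribution_of_function.
Context {R : realType} {n : nat}.
Local Notation C := R[i].
Local Notation E := (n.-tuple (measurableTypeR R)).
Local Notation mu := (@lebesgue_tuple R n).
Implicit Types (phi : E -> C) (x y : E).

Lemma measurable_meval (P : mpoly.mpoly n R) :
  measurable_fun setT (fun x : E => mpoly.meval (tnth x) P).
Proof.
under eq_fun do rewrite mpoly.mevalE.
apply: measurable_sum => m; apply: measurable_funM => //.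
apply: measurable_prod => i _; apply: measurable_funX.
exact: measurable_tnth.
Qed.

Lemma cmeasurable_propagator (P : mpoly.mpoly n R) (t : R) :
  cmeasurable (fun x : E => expi (mpoly.meval (tnth x) P * t)).
Proof.
by apply: cmeasurable_expi; apply: measurable_funM => //; exact: measurable_meval.
Qed.

Variable G : E -> C.
Hypothesis iG : Cintegrable G.

Definition dist_of_fun (h : E -> C) : C := Cintegral (fun x => G x * h x).

(** Since [G] is integrable, the supremum of the test function controls the pairing: the seminorm of
    order 0 is enough. *)
Lemma dist_of_fun_tempered : tempered dist_of_fun.
Proof.
have iGs phi : schwartz phi -> Cintegrable (fun x => G x * phi x).
  move=> sphi; have [M hM] := schwartz_bounded sphi.
  exact: (CintegrableM_le iG (schwartz_measurable sphi) hM).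
split=> [a phi psi sphi spsi|].
  rewrite /dist_of_fun -CintegralZ; last exact: iGs.
  rewrite -CintegralD; [|exact: CintegrableZ (iGs _ sphi)|exact: iGs].
  by apply: eq_Cintegral => x; rewrite mulrDr mulrCA.
exists 0, (2 * \int[mu]_x Normc.normc (G x)) => phi sphi M hM.
have hM' x : Normc.normc (phi x) <= M.
  by have := hM [::] x isT; rewrite /schwartz_term expr0 mul1r.
rewrite /dist_of_fun (le_trans (normc_Cintegral_le (iGs _ sphi)))//.
rewrite -mulrA ler_wpM2l// -RintegralZr//; last exact: integrable_normc.
apply: le_Rintegral => //; first exact: integrable_normc (iGs _ sphi).
  have := integrableZr measurableT M (integrable_normc iG).
  by apply: eq_integrable.
by move=> x _; rewrite Normc.normcM ler_wpM2l// normc_ge0.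
Qed.

Hypothesis ig : Cintegrable (fourier G).

Lemma dist_of_fun_fourier : dist_is_fun (dist_fourier dist_of_fun) (fourier G).
Proof.
split; first exact: Cintegrable_measurable.
move=> phi sphi; have [M hM] := schwartz_bounded sphi; split.
  exact: (CintegrableM_le ig (schwartz_measurable sphi) hM).
rewrite /dist_fourier /dist_of_fun fourier_mult//; last exact: schwartz_integrable.
by apply: eq_Cintegral => x; rewrite mulrC.
Qed.

(** The distribution pairs [G] with the Fourier transform of [m * inv_fourier phi]. One
    multiplication formula moves that transform onto [G], which requires [inv_fourier phi] to be
    integrable; the other moves the inverse transform onto [fourier G * m]. *)
Lemma dist_of_fun_evolution (P : mpoly.mpoly n R) (t : R) :
  dist_is_fun (evolution P t dist_of_fun)
    (inv_fourier (fun xi => fourier G xi * expi (mpoly.meval (tnth xi) P * t))).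
Proof.
pose m (xi : E) : C := expi (mpoly.meval (tnth xi) P * t).
have m1 xi : Normc.normc (m xi) <= 1 by rewrite normc_expi.
have mm : Cmeasurable m by exact: cmeasurable_propagator.
have igm : Cintegrable (fun xi => fourier G xi * m xi).
  exact: (CintegrableM_le ig mm m1).
split; first exact: Cmeasurable_inv_fourier.
move=> phi sphi; have iphi := schwartz_integrable sphi.
have [M hM] := inv_fourier_bounded igm.
split; first exact: (CintegrableMl_le iphi (Cmeasurable_inv_fourier igm) hM).
rewrite /evolution /dist_inv_fourier /dist_mul /dist_fourier /dist_of_fun.
rewrite fourier_mult//; last first.
  exact: (CintegrableMl_le (inv_fourier_integrable sphi) mm m1).
transitivity (Cintegral (fun x => (fourier G x * m x) * inv_fourier phi x)).
  by apply: eq_Cintegral => x; rewrite /m mulrC mulrA.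
rewrite inv_fourier_mult//.
by apply: eq_Cintegral => x; rewrite mulrC.
Qed.

End distribution_of_function.

(** * The packet *)

Section packet.
Context {R : realType} {m : nat}.
Local Notation C := R[i].
Local Notation n := m.+2.
Local Notation E := (n.-tuple (measurableTypeR R)).
Local Notation mu := (@lebesgue_tuple R n).
Implicit Types (x y xi eta : E).

Definition i0 : 'I_n := ord0.
Definition i1 : 'I_n := lift ord0 ord0.

Lemma i1_neq0 : (i1 == i0) = false. Proof. by []. Qed.
Lemma i0_neq1 : (i0 == i1) = false. Proof. by []. Qed.

Variables (a r kap : R).
Hypothesis r0 : 0 < r.

(* Frequencies are written [pack eta]: in the plane of the first two variables,
   [eta] runs over unit size while [pack eta] runs over a segment of length [r] in
   the direction [(1, - kap)], through [(a, a)], thickened by a unit length. *)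
Definition unbend xi : R := a - kap * (tnth xi i0 - a).
Definition pack eta : E :=
  shear i1 1 unbend (shear i0 r (cst a) eta).
Definition unpack xi : E :=
  shear i0 r^-1 (cst (- (a / r))) (shear i1 1 (fun x => - unbend x) xi).

Lemma tnth_pack eta i : tnth (pack eta) i =
  if i == i1 then tnth eta i1 + a - kap * (r * tnth eta i0) else
  if i == i0 then r * tnth eta i0 + a else tnth eta i.
Proof.
rewrite /pack /shear /unbend !tnth_upd i1_neq0 eqxx /=.
by case: ifP => // _; ring.
Qed.

Lemma tnth_unpack xi i : tnth (unpack xi) i =
  if i == i0 then (tnth xi i0 - a) / r else
  if i == i1 then tnth xi i1 - a + kap * (tnth xi i0 - a) else tnth xi i.
Proof.
rewrite /unpack /shear /unbend !tnth_upd i0_neq1 /=.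
by case: ifP => [_|_]; [ring|case: ifP => // _; ring].
Qed.

Lemma packK : cancel pack unpack.
Proof.
move=> eta; apply: eq_from_tnth => i.
rewrite tnth_unpack !tnth_pack i0_neq1 !eqxx.
have [->|ii0] := eqVneq i i0; first by rewrite addrK mulrAC divff ?gt_eqF// mul1r.
by have [->|ii1] := eqVneq i i1; [ring|].
Qed.

Lemma measurable_unbend : measurable_fun setT unbend.
Proof.
apply: measurable_funB => //; apply: measurable_funM => //.
by apply: measurable_funB => //; exact: measurable_tnth.
Qed.

Lemma unbend_upd xi s : unbend (upd i1 xi s) = unbend xi.
Proof. by rewrite /unbend tnth_upd i0_neq1. Qed.

Lemma measurable_pack : measurable_fun setT pack.
Proof.
apply: (measurableT_comp (measurable_shear i1 1 measurable_unbend)).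
exact: measurable_shear.
Qed.

Lemma measurable_unpack : measurable_fun setT unpack.
Proof.
apply: measurableT_comp; first exact: measurable_shear.
by apply: measurable_shear; apply: measurableT_comp => //; exact: measurable_unbend.
Qed.

Lemma ge0_integral_pack (F : E -> \bar R) :
  measurable_fun setT F -> (forall x, 0 <= F x)%E ->
  (\int[mu]_x F x = r%:E * \int[mu]_x F (pack x))%E.
Proof.
move=> mF F0.
rewrite (ge0_integral_shear (i := i1) ltr01 measurable_unbend unbend_upd mF F0) mul1e.
rewrite (ge0_integral_shear (i := i0) (a := r) (b := cst a) r0)//.
exact: (measurableT_comp mF (measurable_shear i1 1 measurable_unbend)).
Qed.

Lemma integrable_pack (F : E -> R) : measurable_fun setT F ->
  mu.-integrable setT (fun x => (F (pack x))%:E) ->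
  mu.-integrable setT (EFin \o F).
Proof.
move=> mF iF.
apply: (integrable_shear (i := i1) ltr01 measurable_unbend unbend_upd mF).
apply: (integrable_shear (i := i0) (a := r) (b := cst a)
  (F := fun x => F (shear i1 1 unbend x)) r0) => //.
exact: (measurableT_comp mF (measurable_shear i1 1 measurable_unbend)).
Qed.

Lemma Rintegral_pack (F : E -> R) : measurable_fun setT F ->
  mu.-integrable setT (fun x => (F (pack x))%:E) ->
  \int[mu]_x F x = r * \int[mu]_x F (pack x).
Proof.
move=> mF iF.
have mF1 := measurableT_comp mF (measurable_shear i1 1 measurable_unbend).
have iF1 : mu.-integrable setT (fun x => (F (shear i1 1 unbend x))%:E).
  exact: (integrable_shear (i := i0) (a := r) (b := cst a)
    (F := fun x => F (shear i1 1 unbend x)) r0).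
rewrite (Rintegral_shear (i := i1) ltr01 measurable_unbend unbend_upd mF iF1) mul1r.
exact: (Rintegral_shear (i := i0) (a := r) (b := cst a)
  (F := fun x => F (shear i1 1 unbend x)) r0).
Qed.

Definition packet_hat xi : C := ((weight (unpack xi))%:C)%C.

Lemma packet_hat_measurable : Cmeasurable packet_hat.
Proof.
apply: cmeasurable_real; exact: (measurableT_comp (@measurable_weight R n) measurable_unpack).
Qed.

Lemma packet_hat_integrable : Cintegrable packet_hat.
Proof.
split; last exact: integrable0.
apply: integrable_pack.
  exact: (measurableT_comp (@measurable_weight R n) measurable_unpack).
rewrite (_ : (fun x => _) = EFin \o @weight R n); first exact: integrable_weight.
by apply/funext => x /=; rewrite packK.
Qed.

(* The transposed shear, on the physical side. *)
Definition spread y : R := kap * tnth y i1.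

Lemma measurable_spread : measurable_fun setT spread.
Proof. by apply: measurable_funM => //; exact: measurable_tnth. Qed.

Lemma spread_upd y s : spread (upd i0 y s) = spread y.
Proof. by rewrite /spread tnth_upd i1_neq0. Qed.

(** The sheared argument has [i0]-th coordinate [r * (x_0 - kap * x_1)]. The factor [2^-1 ^+ n]
    normalizes the transforms 2 / (1 + t^2) of the exponentials, and [r] offsets the Jacobian of the
    shear. *)
Definition packet_env x : R :=
  2^-1 ^+ n * r * expsum (shear i0 r (fun x => - (r * spread x)) x).

(** The modulation translates the frequencies to the point (a, a, 0). *)
Definition packet x : C :=
  ((packet_env x)%:C)%C * expi (a * (tnth x i0 + tnth x i1)).

Lemma measurable_packet_env : measurable_fun setT packet_env.
Proof.
apply: measurable_funM => //; apply: (measurableT_comp (@measurable_expsum R n)).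
apply: measurable_shear; apply: measurableT_comp => //.
by apply: measurable_funM => //; exact: measurable_spread.
Qed.

Lemma packet_env_shear y : packet_env (shear i0 r^-1 spread y) =
  2^-1 ^+ n * r * expsum y.
Proof.
congr (_ * expsum _); apply: eq_from_tnth => i.
rewrite /shear tnth_upd spread_upd !tnth_upd eqxx.
have [->|//] := eqVneq i i0.
by rewrite mulrDr addrK mulrA divff ?gt_eqF// mul1r.
Qed.

Lemma cmeasurable_packet : Cmeasurable packet.
Proof.
apply: cmeasurableM; first exact: cmeasurable_real measurable_packet_env.
apply: cmeasurable_expi; apply: measurable_funM => //.
by apply: measurable_funD; exact: measurable_tnth.
Qed.

Lemma packet_env_ge0 x : 0 <= packet_env x.
Proof.
rewrite /packet_env mulr_ge0 ?(ltW (expsum_gt0 _))// mulr_ge0 ?(ltW r0)//.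
Qed.

Lemma packet_integrable : Cintegrable packet.
Proof.
apply: (@Cintegrable_le _ _ _ packet_env); first exact: cmeasurable_packet.
- apply: (integrable_shear (i := i0) (a := r^-1) (b := spread)).
  + by rewrite invr_gt0.
  + exact: measurable_spread.
  + exact: spread_upd.
  + exact: measurable_packet_env.
  + under eq_fun do rewrite packet_env_shear EFinM.
    exact: integrableZl (integrable_expsum n).
- by move=> x; rewrite Normc.normcM normc_expi mulr1 normc_real ger0_norm ?packet_env_ge0.
Qed.

Lemma sum_i01 (F : 'I_n -> R) :
  \sum_(i < n) F i = F i0 + F i1 + \sum_(i < n | (i != i0) && (i != i1)) F i.
Proof. by rewrite (bigD1 i0)//= (bigD1 i1)//= addrA. Qed.

(** The linear part of [unpack] is the transpose of [shear i0 r^-1 spread], and the modulation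
    accounts for its translation by (a, a, 0). *)
Lemma packet_phase xi y :
  a * (tnth (shear i0 r^-1 spread y) i0 + tnth (shear i0 r^-1 spread y) i1) -
    dotp (shear i0 r^-1 spread y) xi =
  - \sum_(i < n) tnth y i * tnth (unpack xi) i.
Proof.
rewrite /dotp !sum_i01.
rewrite (eq_bigr (fun i => tnth y i * tnth (unpack xi) i)); last first.
  move=> i /andP[/negbTE ii0 /negbTE ii1].
  by rewrite tnth_unpack ii0 ii1 /shear tnth_upd ii0.
rewrite !tnth_unpack /shear !tnth_upd !eqxx i1_neq0 /spread.
by field; rewrite gt_eqF.
Qed.

(** After the change of variables the integral is that of [expsum] against the character of
    frequency [unpack xi]; the Jacobian [r^-1] and the normalization of [packet_env] leave exactly
    [weight], and the sine part is 0. *)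
Lemma fourier_packet : fourier packet = packet_hat.
Proof.
apply/funext => xi; rewrite /fourier /packet_hat.
pose t (i : 'I_n) := tnth (unpack xi) i.
have c0 : 0 < r^-1 by rewrite invr_gt0.
have E1 x : packet x * expi (- dotp x xi) =
    ((packet_env x * cos (a * (tnth x i0 + tnth x i1) - dotp x xi)) +i*
     (packet_env x * sin (a * (tnth x i0 + tnth x i1) - dotp x xi)))%C.
  rewrite /packet -mulrA -expiD /expi.
  by apply/eqP; rewrite eq_complex ReM ImM /= !mul0r subr0 addr0 !eqxx.
have mph : measurable_fun setT (fun x : E => a * (tnth x i0 + tnth x i1) - dotp x xi).
  apply: measurable_funB; last exact: measurable_linear.
  by apply: measurable_funM => //; apply: measurable_funD; exact: measurable_tnth.
have ccos : measurable_fun setT (@cos R : R -> R).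
  by apply: continuous_measurable_fun; exact: continuous_cos.
have csin : measurable_fun setT (@sin R : R -> R).
  by apply: continuous_measurable_fun; exact: continuous_sin.
have [ic is_] := Rintegral_expsum_cos_sin t.
have ec y : packet_env (shear i0 r^-1 spread y) *
    cos (a * (tnth (shear i0 r^-1 spread y) i0 + tnth (shear i0 r^-1 spread y) i1) -
      dotp (shear i0 r^-1 spread y) xi) =
    (2^-1 ^+ n * r) * (expsum y * cos (\sum_(i < n) tnth y i * t i)).
  by rewrite packet_phase cosN packet_env_shear -!mulrA.
have es y : packet_env (shear i0 r^-1 spread y) *
    sin (a * (tnth (shear i0 r^-1 spread y) i0 + tnth (shear i0 r^-1 spread y) i1) -
      dotp (shear i0 r^-1 spread y) xi) =
    (- (2^-1 ^+ n * r)) * (expsum y * sin (\sum_(i < n) tnth y i * t i)).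
  by rewrite packet_phase sinN packet_env_shear; ring.
rewrite (eq_Cintegral E1) /Cintegral /=; apply: (f_equal2 (@Complex R)).
- rewrite (Rintegral_shear (i := i0) c0 measurable_spread spread_upd).
  + under eq_Rintegral do rewrite ec.
    rewrite RintegralZl//; last exact: integrable_expsum_cos.
    have cancel_r (q p : R) : r^-1 * (q * r * p) = q * p by field; rewrite gt_eqF.
    rewrite ic cancel_r /weight.
    rewrite -[X in _ ^+ X](card_ord n) -prodr_const -big_split/=.
    by apply: eq_bigr => i _; rewrite mulrA mulVf// mul1r.
  + apply: measurable_funM; first exact: measurable_packet_env.
    exact: (measurableT_comp ccos mph).
  + under eq_fun do rewrite ec EFinM.
    by apply: integrableZl => //; exact: integrable_expsum_cos.
- rewrite (Rintegral_shear (i := i0) c0 measurable_spread spread_upd).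
  + under eq_Rintegral do rewrite es.
    rewrite RintegralZl//; last exact: integrable_expsum_sin.
    by rewrite is_ !mulr0.
  + apply: measurable_funM; first exact: measurable_packet_env.
    exact: (measurableT_comp csin mph).
  + under eq_fun do rewrite es EFinM.
    by apply: integrableZl => //; exact: integrable_expsum_sin.
Qed.

End packet.

(** * The phase *)

Section polynomial_estimates.
Context {R : realType}.

(** The induction carries the remainder as a multiple [p * v ^+ 3]. That [A] is 0 when [k = 2] is
    recorded so that no condition linking [r] to the cube root of [N ^+ 2] arises in the quadratic
    case. *)
Lemma binomial_remainder (k : nat) (K : R) : 0 <= K ->
  exists2 A : R, 0 <= A /\ (k = 2%N -> A = 0) & forall v : R, `|v| <= K ->
    `|(1 + v) ^+ k - (1 + k%:R * v + 'C(k, 2)%:R * v ^+ 2)| <= A * `|v| ^+ 3.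
Proof.
move=> K0.
suff [A [[A0 Ak] hA]] : exists A : R, (0 <= A /\ ((k <= 2)%N -> A = 0)) /\
    forall v : R, `|v| <= K -> exists2 p : R, `|p| <= A &
    (1 + v) ^+ k = 1 + k%:R * v + 'C(k, 2)%:R * v ^+ 2 + p * v ^+ 3.
  exists A; first by split=> // k2; apply: Ak; rewrite k2.
  move=> v vK; have [p pA ->] := hA v vK.
  by rewrite addrC addKr normrM normrX ler_wpM2r// exprn_ge0.
elim: k => [|k [A [[A0 Ak] hA]]].
  exists 0; split=> [|v _]; first by split.
  by exists 0; rewrite ?normr0// expr0 bin0n !mul0r !addr0.
(* Multiplying the expansion by [1 + v] replaces [p] by [(1 + v) * p + 'C(k, 2)]. *)
exists ((1 + K) * A + 'C(k, 2)%:R); split.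
  split; first by rewrite addr_ge0 ?mulr_ge0 ?addr_ge0.
  by rewrite ltnS => k1; rewrite Ak ?(leq_trans k1)// mulr0 add0r bin_small.
move=> v vK; have [p pA pE] := hA v vK.
exists ((1 + v) * p + 'C(k, 2)%:R).
  rewrite (le_trans (ler_normD _ _))// lerD//; last by rewrite ger0_norm.
  rewrite normrM ler_pM// (le_trans (ler_normD _ _))// normr1 lerD2l//.
by rewrite exprS pE binS bin1 natrD -natr1; ring.
Qed.

(** The predicate [c] lets the same bound serve for the monomials of [P] of degree other than [k]
    and for all those of [Q]. *)
Lemma monomials_bound (n D : nat) (p : mpoly.mpoly n R)
    (c : pred (mpoly.multinom n)) :
  (forall mm, mm \in mpoly.msupp p -> c mm -> (mpoly.mdeg mm <= D)%N) ->
  exists2 K : R, 0 <= K & forall (B : R) (v : 'I_n -> R), 1 <= B ->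
    (forall i, `|v i| <= B) ->
    `|\sum_(mm <- mpoly.msupp p | c mm)
        mpoly.mcoeff mm p * \prod_(i < n) v i ^+ mpoly.fun_of_multinom mm i|
      <= K * B ^+ D.
Proof.
move=> pD; exists (\sum_(mm <- mpoly.msupp p | c mm) `|mpoly.mcoeff mm p|).
  by apply: sumr_ge0.
move=> B v B1 vB; have B0 : 0 <= B by exact: le_trans B1.
rewrite mulr_suml (le_trans (ler_norm_sum _ _ _))//.
rewrite big_seq_cond [leRHS]big_seq_cond; apply: ler_sum => mm /andP[mmp cm].
rewrite normrM ler_wpM2l// normr_prod.
apply: (@le_trans _ _ (B ^+ mpoly.mdeg mm)); last by rewrite ler_weXn2l// pD.
rewrite mpoly.mdegE -prodrXr; apply: ler_prod => i _; rewrite normr_ge0/= normrX.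
by rewrite lerXn2r// nnegrE.
Qed.

End polynomial_estimates.

Section phase.
Context {R : realType} {m : nat}.
Local Notation n := m.+2.
Local Notation E := (n.-tuple (measurableTypeR R)).
Local Notation i0 := (@i0 m).
Local Notation i1 := (@i1 m).

Variables (k : nat) (P : mpoly.mpoly n R) (c1 c2 : R) (Q : mpoly.mpoly m R).
Hypothesis k2 : (2 <= k)%N.
Hypothesis Pk : mpoly.msize P = k.+1.
Hypotheses (c10 : 0 < c1) (c20 : 0 < c2).
Hypothesis PE : homog_part k P =
    c1 *: mvar ord0 ^+ k - c2 *: mvar (lift ord0 ord0) ^+ k + shift2 Q.

Lemma meval_leading v : mpoly.meval v (homog_part k P) =
  c1 * v i0 ^+ k - c2 * v i1 ^+ k + mpoly.meval (fun i => v (rshift 2 i)) Q.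
Proof.
rewrite PE mpoly.mevalD mpoly.mevalB !mpoly.mevalZ !rmorphXn /=.
rewrite !mpoly.mevalXU /shift2 mpoly.comp_mpoly_meval.
congr (_ + _); apply: mpoly.meval_eq => i.
by rewrite tnth_mktuple mpoly.mevalXU.
Qed.

Lemma meval_lower : exists2 K : R, 0 <= K &
  forall (B : R) (v : 'I_n -> R), 1 <= B -> (forall i, `|v i| <= B) ->
  `|mpoly.meval v P - mpoly.meval v (homog_part k P)| <= K * B ^+ k.-1.
Proof.
have [|K K0 hK] := @monomials_bound R n k.-1 P (fun mm => mpoly.mdeg mm != k).
  move=> mm /mpoly.msize_mdeg_lt; rewrite Pk ltnS leq_eqVlt => /orP[->//|mk _].
  by rewrite -ltnS prednK// (leq_trans _ k2).
exists K => // B v B1 vB.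
rewrite (_ : _ - _ = \sum_(mm <- mpoly.msupp P | mpoly.mdeg mm != k)
  mpoly.mcoeff mm P * \prod_(i < n) v i ^+ mpoly.fun_of_multinom mm i).
  exact: hK.
have -> : mpoly.meval v (homog_part k P) =
    \sum_(mm <- mpoly.msupp P | mpoly.mdeg mm == k)
      mpoly.mcoeff mm P * \prod_(i < n) v i ^+ mpoly.fun_of_multinom mm i.
  rewrite /homog_part mpoly.pihomogE raddf_sum /=.
  by apply: eq_bigr => mm _; rewrite mpoly.mevalZ mpoly.mevalX.
rewrite mpoly.mevalE (bigID (fun mm => mpoly.mdeg mm == k))/=.
by rewrite addrAC subrr add0r.
Qed.

(** It is applied only with [B = L], which does not grow with [N], so a crude exponent is
    harmless. *)
Lemma meval_form : exists2 K : R, 0 <= K &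
  forall (B : R) (v : 'I_m -> R), 1 <= B -> (forall i, `|v i| <= B) ->
  `|mpoly.meval v Q| <= K * B ^+ (mpoly.msize Q).
Proof.
have [|K K0 hK] := @monomials_bound R m (mpoly.msize Q) Q predT.
  by move=> mm /mpoly.msize_mdeg_lt /ltnW.
by exists K => // B v B1 vB; rewrite mpoly.mevalE; exact: hK.
Qed.

Variables (kap L A : R).
Hypotheses (kap0 : 0 < kap) (c12 : c1 = c2 * kap ^+ 2) (L1 : 1 <= L).
Hypothesis A0 : 0 <= A.
Hypothesis hA : forall v : R, `|v| <= (kap + 1) * L ->
  `|(1 + v) ^+ k - (1 + k%:R * v + 'C(k, 2)%:R * v ^+ 2)| <= A * `|v| ^+ 3.

(** N |w / N|^3 = |w|^3 / N^2 <= B^3 r^3 / N^2: this is the place where [r ^+ 3 <= N ^+ 2]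
    enters. *)
Lemma cubic_remainder (N r B w : R) : 1 <= r -> r <= N ->
  A = 0 \/ r ^+ 3 <= N ^+ 2 -> 0 <= B <= (kap + 1) * L -> `|w| <= B * r ->
  N * `|(1 + w / N) ^+ k - (1 + k%:R * (w / N) + 'C(k, 2)%:R * (w / N) ^+ 2)| <=
  A * B ^+ 3.
Proof.
move=> r1 rN Ar /andP[B0 BL] wB.
have N0 : 0 < N by rewrite (lt_le_trans _ rN)// (lt_le_trans _ r1).
have wN : `|w / N| = `|w| / N by rewrite normrM (gtr0_norm (x := N^-1)) ?invr_gt0.
have wL : `|w / N| <= (kap + 1) * L.
  rewrite wN ler_pdivrMr// (le_trans wB)// ler_pM//.
  by rewrite (le_trans ler01).
apply: (@le_trans _ _ (N * (A * `|w / N| ^+ 3))).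
  by rewrite ler_pM2l//; exact: hA.
have -> : N * (A * `|w / N| ^+ 3) = A * (`|w| ^+ 3 / N ^+ 2).
  by rewrite wN; field; rewrite gt_eqF.
case: Ar => [->|rN2]; first by rewrite !mul0r.
rewrite ler_wpM2l// ler_pdivrMr ?exprn_gt0//.
apply: (@le_trans _ _ ((B * r) ^+ 3)).
  by rewrite lerXn2r ?nnegrE ?mulr_ge0// (le_trans ler01).
by rewrite exprMn ler_wpM2l// exprn_ge0.
Qed.

Definition planar_const : R := k%:R * c2 * L + 'C(k, 2)%:R * (c2 * (2 * kap + 1) * L ^+ 2)
  + (c1 * (A * L ^+ 3) + c2 * (A * ((kap + 1) * L) ^+ 3)).

(* The quadratic part of [c1 X^k - c2 Y^k] at (1, 1) vanishes in the direction
   (1, - kap), so that only the cubic part limits the length of the packet. *)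
Lemma planar_phase (N r t y e : R) : 1 <= r -> r <= N ->
  A = 0 \/ r ^+ 3 <= N ^+ 2 -> 0 <= t -> `|y| <= r * L -> `|e| <= L ->
  `|t * (c1 * (N + y) ^+ k - c2 * (N + (e - kap * y)) ^+ k) -
    t * N ^+ k * (c1 - c2) -
    k%:R * (t * N ^+ k.-1) * (c1 + c2 * kap) * y| <=
  t * N ^+ k.-1 * planar_const.
Proof.
move=> r1 rN Ar t0 yL eL.
have N1 : 1 <= N by exact: le_trans rN.
have N0 : 0 < N by rewrite (lt_le_trans _ N1).
have L0 : 0 <= L by rewrite (le_trans ler01).
have r0 : 0 <= r by rewrite (le_trans ler01).
have Nk : N ^+ k = N * N ^+ k.-1 by rewrite -exprS prednK// (leq_trans _ k2).
set v := y / N; set w := (e - kap * y) / N.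
set R0 := (1 + v) ^+ k - (1 + k%:R * v + 'C(k, 2)%:R * v ^+ 2).
set R1 := (1 + w) ^+ k - (1 + k%:R * w + 'C(k, 2)%:R * w ^+ 2).
have Ev : (N + y) ^+ k = N ^+ k * (1 + k%:R * v + 'C(k, 2)%:R * v ^+ 2 + R0).
  rewrite /R0 [X in _ ^+ _ * X]addrC subrK -exprMn; congr (_ ^+ _).
  by rewrite /v; field; rewrite gt_eqF.
have Ew : (N + (e - kap * y)) ^+ k =
    N ^+ k * (1 + k%:R * w + 'C(k, 2)%:R * w ^+ 2 + R1).
  rewrite /R1 [X in _ ^+ _ * X]addrC subrK -exprMn; congr (_ ^+ _).
  by rewrite /w; field; rewrite gt_eqF.
have hR0 : N * `|R0| <= A * L ^+ 3.
  apply: (cubic_remainder (r := r)) => //; last by rewrite mulrC.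
  by rewrite L0 ler_peMl// lerDr ltW.
have hR1 : N * `|R1| <= A * ((kap + 1) * L) ^+ 3.
  apply: (cubic_remainder (r := r)) => //.
    by rewrite lexx mulr_ge0// addr_ge0 ?ltW.
  rewrite (le_trans (ler_normB _ _))// normrM (gtr0_norm kap0).
  rewrite addrC mulrDl mul1r mulrDl lerD//.
    by rewrite -mulrA ler_pM2l// mulrC.
  by rewrite (le_trans eL)// ler_peMr.
rewrite Ev Ew.
(* The relation [c12] removes the terms in [y ^+ 2]; every quadratic term left contains [e], and
   since |y| <= r L <= N L it is bounded after the division by [N]. *)
have -> : t * (c1 * (N ^+ k * (1 + k%:R * v + 'C(k, 2)%:R * v ^+ 2 + R0)) -
    c2 * (N ^+ k * (1 + k%:R * w + 'C(k, 2)%:R * w ^+ 2 + R1))) -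
    t * N ^+ k * (c1 - c2) - k%:R * (t * N ^+ k.-1) * (c1 + c2 * kap) * y =
    t * N ^+ k.-1 * (- (k%:R * c2 * e) +
      'C(k, 2)%:R * (c2 * (2 * kap * (y * e / N) - e * e / N)) +
      (c1 * (N * R0) - c2 * (N * R1))).
  rewrite Nk c12 /v /w; move: (N ^+ k.-1) (k%:R) ('C(k, 2)%:R) => D kR bR.
  by field; rewrite gt_eqF.
rewrite normrM ger0_norm ?mulr_ge0 ?exprn_ge0 ?(ltW N0)//.
rewrite ler_wpM2l ?mulr_ge0 ?exprn_ge0 ?(ltW N0)// /planar_const.
have yeN : `|y * e / N| <= L ^+ 2.
  rewrite normrM normrM (gtr0_norm (x := N^-1)) ?invr_gt0// ler_pdivrMr//.
  apply: (@le_trans _ _ (r * L * L)); first by rewrite ler_pM.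
  by rewrite -mulrA -expr2 mulrC ler_wpM2l// exprn_ge0.
have eeN : `|e * e / N| <= L ^+ 2.
  rewrite normrM normrM (gtr0_norm (x := N^-1)) ?invr_gt0// ler_pdivrMr//.
  apply: (@le_trans _ _ (L * L)); first by rewrite ler_pM.
  by rewrite -expr2 ler_peMr// exprn_ge0.
rewrite (le_trans (ler_normD _ _))// lerD//.
  rewrite (le_trans (ler_normD _ _))// lerD//.
    by rewrite normrN normrM ger0_norm ?mulr_ge0 ?(ltW c20)// ler_wpM2l// mulr_ge0// ltW.
  rewrite normrM ger0_norm// ler_wpM2l// normrM (gtr0_norm c20) -[leRHS]mulrA ler_pM2l//.
  rewrite (le_trans (ler_normB _ _))// [leRHS]mulrDl mul1r lerD//.
  by rewrite normrM ger0_norm ?mulr_ge0 ?(ltW kap0)// ler_wpM2l// mulr_ge0// ltW.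
rewrite (le_trans (ler_normB _ _))// !normrM (gtr0_norm c10) (gtr0_norm c20).
by rewrite (gtr0_norm N0) lerD// ler_pM2l.
Qed.

(** Three kinds of error make up [K]: [y] times its coefficient, at most [L * rho]; products of a
    coordinate of [x] with one of [eta], at most [2 * L * rho] each; and terms of size
    [t * N ^+ k.-1], a quantity that the condition on the coefficient of [y] forces to be O(rho). *)
Lemma phase_bound : exists2 K : R, 0 <= K &
  forall (N r rho t : R) (x eta : E), 1 <= r -> r <= N ->
  A = 0 \/ r ^+ 3 <= N ^+ 2 -> 0 <= rho -> 0 <= t ->
  (forall i, `|tnth x i| <= 2 * rho) ->
  `|tnth x i0 - kap * tnth x i1 + k%:R * (t * N ^+ k.-1) * (c1 + c2 * kap)| * r <= rho ->
  (forall i, `|tnth eta i| <= L) ->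
  `|mpoly.meval (tnth (pack N r kap eta)) P * t + dotp x (pack N r kap eta) -
    (t * N ^+ k * (c1 - c2) + N * (tnth x i0 + tnth x i1))| <= K * rho.
Proof.
have [KS KS0 hS] := meval_lower; have [KQ KQ0 hQ] := meval_form.
have L0 : 0 <= L by rewrite (le_trans ler01).
have k0 : 0 < k%:R :> R by rewrite ltr0n (leq_trans _ k2).
pose c := k%:R * (c1 + c2 * kap).
have c0 : 0 < c by rewrite mulr_gt0// addr_gt0// mulr_gt0.
pose KB := 1 + (kap + 1) * L.
have KB1 : 1 <= KB by rewrite lerDl mulr_ge0// addr_ge0 ?ltW.
pose D := planar_const + KQ * L ^+ mpoly.msize Q + KS * KB ^+ k.-1.
have p0 : 0 <= planar_const.
  have kp : 0 <= kap by exact: ltW.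
  by rewrite /planar_const !addr_ge0// ?mulr_ge0 ?exprn_ge0 ?addr_ge0 ?mulr_ge0
    ?exprn_ge0 ?addr_ge0 ?(ltW c10) ?(ltW c20) ?mulr_ge0 ?addr_ge0.
have D0 : 0 <= D.
  have KB0 : 0 <= KB by rewrite (le_trans ler01).
  have q1 : 0 <= KQ * L ^+ mpoly.msize Q by rewrite mulr_ge0// exprn_ge0.
  have q2 : 0 <= KS * KB ^+ k.-1 by rewrite mulr_ge0// exprn_ge0.
  exact: addr_ge0 (addr_ge0 p0 q1) q2.
exists (L + n%:R * (2 * L) + (3 + 2 * kap) / c * D).
  have q3 : 0 <= (3 + 2 * kap) / c.
    by apply: divr_ge0 (ltW c0); rewrite addr_ge0// mulr_ge0// ltW.
  have q4 : 0 <= n%:R * (2 * L) by rewrite !mulr_ge0.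
  exact: addr_ge0 (addr_ge0 L0 q4) (mulr_ge0 q3 D0).
move=> N r rho t x eta r1 rN Ar rho0 t0 xrho dev etaL.
have N1 : 1 <= N by exact: le_trans rN.
have r0 : 0 < r by rewrite (lt_le_trans ltr01).
have N0 : 0 < N by rewrite (lt_le_trans ltr01).
set xi := pack N r kap eta; set y := r * tnth eta i0.
set T := t * N ^+ k.-1.
have T0 : 0 <= T by rewrite mulr_ge0// exprn_ge0// ltW.
have yL : `|y| <= r * L by rewrite normrM gtr0_norm// ler_pM2l.
have xi0E : tnth xi i0 = N + y by rewrite tnth_pack i0_neq1 eqxx addrC.
have xi1E : tnth xi i1 = N + (tnth eta i1 - kap * y).
  by rewrite tnth_pack eqxx -addrA addrCA addrA.
have dot : dotp x xi = tnth x i0 * (N + y) + tnth x i1 * (N + (tnth eta i1 - kap * y)) +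
    \sum_(i < n | (i != i0) && (i != i1)) tnth x i * tnth eta i.
  rewrite /dotp sum_i01 xi0E xi1E; congr (_ + _); apply: eq_bigr.
  by move=> i /andP[/negbTE ii0 /negbTE ii1]; rewrite tnth_pack ii0 ii1.
set S := \sum_(i < n | (i != i0) && (i != i1)) tnth x i * tnth eta i in dot *.
have xe i : `|tnth x i * tnth eta i| <= 2 * L * rho.
  by rewrite normrM mulrAC ler_pM.
have SL : `|tnth x i1 * tnth eta i1 + S| <= n%:R * (2 * L) * rho.
  have -> : tnth x i1 * tnth eta i1 + S = \sum_(i < n | i != i0) tnth x i * tnth eta i.
    by rewrite (bigD1 i1).
  rewrite (le_trans (ler_norm_sum _ _ _))//.
  apply: (@le_trans _ _ (\sum_(i < n) 2 * L * rho)).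
    rewrite [leRHS](bigID (fun i => i != i0))/= ler_wpDr//.
      by apply: sumr_ge0 => i _; rewrite !mulr_ge0.
    by apply: ler_sum => i _; exact: xe.
  by rewrite sumr_const card_ord -[leRHS]mulrA [leRHS]mulr_natl.
(* As [r >= 1], the coefficient of [y] is itself at most [rho]; moving the two coordinates of [x] to
   the other side costs [2 * rho] and [2 * kap * rho]. *)
have Tc : T <= (3 + 2 * kap) / c * rho.
  rewrite mulrAC ler_pdivlMr//.
  have d1 : `|tnth x i0 - kap * tnth x i1 + k%:R * T * (c1 + c2 * kap)| <= rho.
    by rewrite (le_trans _ dev)// ler_peMr.
  have d2 := le_trans (ler_norm _) d1.
  have := xrho i0; have := xrho i1; rewrite !ler_norml => /andP[_ h1] /andP[h0 _].
  have h1' : kap * tnth x i1 <= kap * (2 * rho) by rewrite ler_pM2l.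
  rewrite /c; rewrite [X in X <= _](_ : _ = k%:R * T * (c1 + c2 * kap)); last by ring.
  lra.
have hp := planar_phase r1 rN Ar t0 yL (etaL i1).
have hSt : `|t * (mpoly.meval (tnth xi) P - mpoly.meval (tnth xi) (homog_part k P))| <=
    T * (KS * KB ^+ k.-1).
  rewrite normrM ger0_norm// /T -[leRHS]mulrA ler_wpM2l//.
  have KBN : 1 <= KB * N by rewrite mulr_ege1.
  have hB i : `|tnth xi i| <= KB * N.
    have rLN : r * L <= N * L by rewrite ler_wpM2r.
    have LN : L <= N * L by rewrite ler_peMl.
    have kLN : 0 <= kap * L * N by exact: mulr_ge0 (mulr_ge0 (ltW kap0) L0) (ltW N0).
    have EB : KB * N = N + N * L + kap * L * N by rewrite /KB; ring.
    have [->|ii0] := eqVneq i i0.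
      rewrite xi0E (le_trans (ler_normD _ _))// gtr0_norm// EB -addrA lerD2l.
      by rewrite (le_trans yL)// (le_trans rLN)// lerDl.
    have [->|ii1] := eqVneq i i1.
      rewrite xi1E (le_trans (ler_normD _ _))// gtr0_norm// EB -addrA lerD2l.
      rewrite (le_trans (ler_normB _ _))// normrM (gtr0_norm kap0) lerD//.
        by rewrite (le_trans (etaL _)).
      by rewrite -mulrA ler_pM2l// (le_trans yL)// [L * N]mulrC.
    rewrite tnth_pack (negbTE ii0) (negbTE ii1) (le_trans (etaL i))//.
    by rewrite (le_trans LN)// EB -addrA addrCA lerDl addr_ge0// ltW.
  rewrite (le_trans (hS _ _ KBN hB))// exprMn [leLHS]mulrA.
  by rewrite [leRHS]mulrC.
have hQt : `|t * mpoly.meval (fun i => tnth xi (rshift 2 i)) Q| <=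
    T * (KQ * L ^+ mpoly.msize Q).
  rewrite normrM ger0_norm// ler_pM//.
    by rewrite /T ler_peMr// exprn_ege1.
  apply: hQ => // i; rewrite tnth_pack.
  have -> : (rshift 2 i == i1) = false by [].
  have -> : (rshift 2 i == i0) = false by [].
  exact: etaL.
have -> : mpoly.meval (tnth xi) P * t + dotp x xi -
    (t * N ^+ k * (c1 - c2) + N * (tnth x i0 + tnth x i1)) =
    y * (tnth x i0 - kap * tnth x i1 + k%:R * T * (c1 + c2 * kap)) +
    (tnth x i1 * tnth eta i1 + S) +
    ((t * (c1 * (N + y) ^+ k - c2 * (N + (tnth eta i1 - kap * y)) ^+ k) -
      t * N ^+ k * (c1 - c2) - k%:R * T * (c1 + c2 * kap) * y) +
     t * mpoly.meval (fun i => tnth xi (rshift 2 i)) Q +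
     t * (mpoly.meval (tnth xi) P - mpoly.meval (tnth xi) (homog_part k P))).
  by rewrite meval_leading xi0E xi1E dot; ring.
rewrite (le_trans (ler_normD _ _))// [leRHS]mulrDl lerD//.
  rewrite (le_trans (ler_normD _ _))// [leRHS]mulrDl lerD//.
  rewrite normrM (le_trans (ler_wpM2r _ yL))// mulrAC mulrC.
  by rewrite ler_wpM2l// mulrC.
apply: (@le_trans _ _ (T * D)).
  have -> : T * D = T * planar_const + T * (KQ * L ^+ mpoly.msize Q) +
      T * (KS * KB ^+ k.-1) by rewrite /D !mulrDr.
  apply: le_trans (ler_normD _ _) _; apply: lerD hSt.
  by apply: le_trans (ler_normD _ _) _; exact: lerD hp hQt.
by rewrite [leRHS]mulrAC ler_wpM2r.
Qed.

End phase.

(** * Lower bounds for oscillatory integrals *)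

Section cos_near_zero.
Context {R : realType}.

Lemma cos_ge_half : exists2 d : R, 0 < d & forall y : R, `|y| <= d -> 1 / 2 <= cos y.
Proof.
have /cvgrPdist_le /(_ (1 / 2) ltac:(lra)) := @continuous_cos R 0.
move=> /nbhs_ballP[e /= e0 he]; exists (e / 2); first by lra.
move=> y ye; have := he y; rewrite /ball /= sub0r normrN => /(_ _).
rewrite cos0 ler_norml => H; have /andP[_] : - (1 / 2) <= 1 - cos y <= 1 / 2.
  by apply: H; lra.
lra.
Qed.

End cos_near_zero.

Section boxes.
Context {R : realType} {n : nat}.
Local Notation E := (n.-tuple (measurableTypeR R)).
Local Notation mu := (@lebesgue_tuple R n).
Implicit Types (x y : E).

Definition cube (L : R) : set E := [set x | forall i, `|tnth x i| <= L].

Lemma measurable_forall_tnth (A : 'I_n -> set R) : (forall i, measurable (A i)) ->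
  measurable [set x : E | forall i, A i (tnth x i)].
Proof.
move=> mA.
rewrite (_ : mkset _ =
    \bigcap_(i in [set: 'I_n]) ((@tnth n (measurableTypeR R))^~ i @^-1` A i)).
  apply: fin_bigcap_measurable => // i _.
  rewrite -[X in measurable X]setTI; apply: (measurable_tnth i) => //.
  exact: mA.
by apply/seteqP; split => [x Ax i _|x Ax i]; exact: Ax.
Qed.

Lemma measurable_cube L : measurable (cube L).
Proof.
rewrite (_ : cube L = [set x | forall i, `[- L, L]%classic (tnth x i)]).
  apply: (measurable_forall_tnth (A := fun=> `[- L, L]%classic)) => i.
  exact: measurable_itv.
by apply/seteqP; split => x Lx i; have := Lx i; rewrite /= in_itv/= ler_norml.
Qed.

Lemma bigcup_cube : \bigcup_k cube k.+1%:R = setT.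
Proof.
rewrite -subTset => x _.
exists (Num.truncn (\sum_i `|tnth x i|)) => // i.
apply: (@le_trans _ _ (\sum_i `|tnth x i|)).
  by rewrite (bigD1 i)//= lerDl sumr_ge0.
by rewrite ltW// truncnS_gt.
Qed.

(** Cubes exhaust the space, so the limit of their masses is [pi ^+ n]. Any fraction above 2/3 would
    do in place of 3/4 for the next lemma. *)
Lemma weight_concentrates : exists2 L : R, 1 <= L &
  3 / 4 * pi ^+ n <= \int[mu]_(x in cube L) weight x.
Proof.
have mw (D : set E) : measurable_fun D (fun x => (weight x)%:E).
  by apply/measurable_EFinP; apply: measurable_funTS; exact: measurable_weight.
have := @ge0_nondecreasing_set_cvg_integral _ _ _ (fun k => cube k.+1%:R)
  (fun x => (weight x)%:E) mu.
rewrite bigcup_cube integral_weight => h.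
have {h} cvg_w :
    (\int[mu]_(x in cube i.+1%:R) (weight x)%:E)%E @[i --> \oo] --> ((pi : R) ^+ n)%:E.
  apply: h => //.
  - move=> i j ij; apply/subsetPset => x ix l; rewrite (le_trans (ix l))//.
    by rewrite ler_nat.
  - by move=> i; exact: measurable_cube.
  - by move=> i x _; rewrite lee_fin ltW// weight_gt0.
have p0 : 0 < (pi : R) ^+ n by rewrite exprn_gt0// pi_gt0.
have [[k hk]|nk] := pselect (exists k,
    ((3 / 4 * pi ^+ n : R)%:E <= \int[mu]_(x in cube k.+1%:R) (weight x)%:E)%E); last first.
  have : ((pi ^+ n : R)%:E <= (3 / 4 * pi ^+ n : R)%:E)%E.
    apply: (cvge_le _ cvg_w); apply: nearW => k; rewrite leNgt; apply/negP => hk.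
    by apply: nk; exists k; exact: ltW.
  by rewrite lee_fin => ?; exfalso; lra.
exists k.+1%:R; first by rewrite ler1n.
rewrite /Rintegral -lee_fin fineK//.
apply: integrable_fin_num; first exact: measurable_cube.
by apply: integrableS (integrable_weight n) => //; exact: measurable_cube.
Qed.

(** The integrand is at least [weight / 2] on the cube and [- weight] elsewhere, that is, at least
    [3 / 2 * wL - weight]; with mass 3/4 on the cube this leaves 9/8 - 1 = 1/8. *)
Lemma oscillatory_lower (L : R) (h : E -> R) : measurable_fun setT h ->
  3 / 4 * pi ^+ n <= \int[mu]_(x in cube L) weight x ->
  (forall x, cube L x -> 1 / 2 <= cos (h x)) ->
  pi ^+ n / 8 <= \int[mu]_x (weight x * cos (h x)).
Proof.
move=> mh hL hcos.
have iw : mu.-integrable setT (fun x => (weight x)%:E) := integrable_weight n.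
have mcos : measurable_fun setT (fun x : E => cos (h x)).
  apply: (measurableT_comp (f := @cos R)) => //.
  by apply: continuous_measurable_fun; exact: continuous_cos.
have iwc : mu.-integrable setT (fun x => (weight x * cos (h x))%:E).
  apply: (le_integrable measurableT _ _ iw).
    by apply/measurable_EFinP; apply: measurable_funM => //; exact: measurable_weight.
  move=> x _ /=; rewrite lee_fin normrM ler_piMr// cos_norm_le1//.
pose wL := (@weight R n) \_ (cube L).
have iwL : mu.-integrable setT (EFin \o wL).
  rewrite /wL -restrict_EFin; apply/integrable_restrict => //; first exact: measurable_cube.
  by rewrite setTI; apply: integrableS iw => //; exact: measurable_cube.
have iwL2 : mu.-integrable setT (fun x => (3 / 2 * wL x)%:E).
  by have := integrableZl measurableT (3 / 2) iwL; apply: eq_integrable.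
have ew : \int[mu]_x weight x = pi ^+ n by rewrite /Rintegral integral_weight.
have : \int[mu]_x (3 / 2 * wL x - weight x) <= \int[mu]_x (weight x * cos (h x)).
  apply: le_Rintegral => //.
    exact: (eq_integrable measurableT) (integrableB measurableT iwL2 iw).
  move=> x _; rewrite /wL patchE; case: ifPn => [/set_mem /hcos hx|_].
    by have := ler_wpM2l (ltW (weight_gt0 x)) hx; lra.
  rewrite mulr0 sub0r; have := ler_wpM2l (ltW (weight_gt0 x)) (cos_geN1 (h x)); lra.
apply: le_trans; rewrite RintegralB// RintegralZl// -Rintegral_mkcond ew.
lra.
Qed.

End boxes.

(** * Size of the evolved packet and its Sobolev norm *)

Section packet_estimates.
Context {R : realType} {m : nat}.
Local Notation C := R[i].
Local Notation n := m.+2.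
Local Notation E := (n.-tuple (measurableTypeR R)).
Local Notation mu := (@lebesgue_tuple R n).
Implicit Types (x y xi eta : E).

Lemma two_pi_gt0 : 0 < (2 * pi : R) ^- n.
Proof. by rewrite invr_gt0 exprn_gt0// mulr_gt0// pi_gt0. Qed.

(** [al] is the part of the phase that does not depend on the frequency. It is rotated away, and the
    frequencies are rescaled to [eta]; the Jacobian gives the factor [r]. *)
Lemma inv_fourier_packet_lower (a r kap L t al : R) (P : mpoly.mpoly n R) x :
  0 < r -> 3 / 4 * pi ^+ n <= \int[mu]_(y in cube L) weight y ->
  (forall eta, cube L eta -> 1 / 2 <=
    cos (mpoly.meval (tnth (pack a r kap eta)) P * t + dotp x (pack a r kap eta) - al)) ->
  (2 * pi) ^- n * (r * (pi ^+ n / 8)) <= Normc.normc (inv_fourier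
    (fun xi => packet_hat a r kap xi * expi (mpoly.meval (tnth xi) P * t)) x).
Proof.
move=> r0 hL hcos.
pose ph xi := mpoly.meval (tnth xi) P * t + dotp x xi - al.
have mph : measurable_fun setT ph.
  apply: measurable_funB => //; apply: measurable_funD.
    by apply: measurable_funM => //; exact: measurable_meval.
  rewrite (_ : dotp x = fun xi => dotp xi x); first exact: measurable_linear.
  by apply/funext => xi; exact: dotpC.
pose u xi := packet_hat a r kap xi * expi (mpoly.meval (tnth xi) P * t) * expi (dotp x xi).
have iu : Cintegrable u.
  apply: Cintegral_expi_dotp_integrable.
  apply: (CintegrableM_le (packet_hat_integrable a kap r0) (cmeasurable_propagator P t)).
  by move=> xi; rewrite normc_expi.
have mw : measurable_fun setT (fun xi : E => weight (unpack a r kap xi) * cos (ph xi)).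
  apply: measurable_funM.
    exact: (measurableT_comp (@measurable_weight R n) (measurable_unpack a r kap)).
  apply: (measurableT_comp (f := @cos R)) => //.
  by apply: continuous_measurable_fun; exact: continuous_cos.
rewrite /inv_fourier Normc.normcM normc_real gtr0_norm ?two_pi_gt0//.
rewrite ler_pM2l ?two_pi_gt0//.
apply: le_trans (rotate_le_normc al _); rewrite -/(Cintegral u).
have [iu1 iu2] := iu.
have iZ (c : R) (f : E -> R) : mu.-integrable setT (EFin \o f) ->
    mu.-integrable setT (fun y => (c * f y)%:E).
  by move=> /(integrableZl measurableT c); apply: eq_integrable.
have -> : cos al * complex.Re (Cintegral u) + sin al * complex.Im (Cintegral u) =
    \int[mu]_xi (weight (unpack a r kap xi) * cos (ph xi)).
  rewrite /Cintegral -(RintegralZl (cos al) measurableT iu1).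
  rewrite -(RintegralZl (sin al) measurableT iu2) -RintegralD//; [|exact: iZ|exact: iZ].
  apply: eq_Rintegral => xi _.
  rewrite /u /packet_hat -mulrA -expiD ReM ImM /= !mul0r subr0 addr0.
  by rewrite /ph (cosD (_ + _) (- al)) sinN cosN; ring.
have iw : mu.-integrable setT
    (fun eta => (weight (unpack a r kap (pack a r kap eta)) * cos (ph (pack a r kap eta)))%:E).
  apply: (le_integrable measurableT _ _ (integrable_weight n)).
    by apply/measurable_EFinP; exact: (measurableT_comp mw (measurable_pack a r kap)).
  move=> eta _ /=; rewrite lee_fin packK// normrM ler_piMr// cos_norm_le1//.
rewrite (Rintegral_pack r0 mw iw) ler_pM2l//.
under eq_Rintegral do rewrite packK//.
apply: (oscillatory_lower (L := L)) => //.
exact: (measurableT_comp mph (measurable_pack a r kap)).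
Qed.

Lemma sqr_enorm x : enorm x ^+ 2 = \sum_(i < n) tnth x i ^+ 2.
Proof. by rewrite sqr_sqrtr ?dotp_ge0//; apply: eq_bigr => i _; rewrite expr2. Qed.

Lemma oneDsqr_le_weightV x i : 1 + tnth x i ^+ 2 <= (weight x)^-1.
Proof.
have h := weight_le x i; have w0 := weight_gt0 x.
by rewrite -[leLHS]/(oneDsqr (tnth x i)) -[leLHS]invrK lef_pV2 ?posrE ?oneDsqrV_gt0.
Qed.

(** Every 1 + eta_i^2 is at most the inverse of [weight eta]. The constant 6 collects 1 for the
    initial term, 2 for the coordinate [i0] and 3 for [i1], which also yields [3 * kap ^+ 2]. *)
Lemma sqr_enorm_pack (N r kap : R) eta : 1 <= N -> 0 < r -> r <= N ->
  1 + enorm (pack N r kap eta) ^+ 2 <=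
  (6 + 3 * kap ^+ 2 + n%:R) * N ^+ 2 * (weight eta)^-1.
Proof.
move=> N1 r0 rN; set W := (weight eta)^-1.
have hW i : 1 + tnth eta i ^+ 2 <= W := oneDsqr_le_weightV eta i.
have W1 : 1 <= W by rewrite (le_trans _ (hW i0))// lerDl sqr_ge0.
have W0 : 0 <= W by rewrite (le_trans ler01).
have NN : 1 <= N ^+ 2 by rewrite exprn_ege1.
have WN : W <= N ^+ 2 * W by rewrite ler_peMl.
rewrite sqr_enorm sum_i01 !tnth_pack i0_neq1 !eqxx.
set e0 := tnth eta i0; set e1 := tnth eta i1.
have rest : \sum_(i < n | (i != i0) && (i != i1)) tnth (pack N r kap eta) i ^+ 2
    <= n%:R * (N ^+ 2 * W).
  apply: (@le_trans _ _ (\sum_(i < n) (N ^+ 2 * W))); last first.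
    by rewrite sumr_const card_ord [leRHS]mulr_natl.
  rewrite [leRHS](bigID (fun i => (i != i0) && (i != i1)))/= ler_wpDr//.
    by apply: sumr_ge0 => i _; rewrite mulr_ge0// sqr_ge0.
  apply: ler_sum => i /andP[/negbTE ii0 /negbTE ii1]; rewrite tnth_pack ii0 ii1.
  by rewrite (le_trans _ WN)// (le_trans _ (hW i))// lerDr.
have r2 : r ^+ 2 <= N ^+ 2 by rewrite lerXn2r ?nnegrE ?(ltW r0)// (le_trans ler01).
have b0 : r ^+ 2 * e0 ^+ 2 <= N ^+ 2 * e0 ^+ 2 by rewrite ler_wpM2r// sqr_ge0.
have k2 : 0 <= kap ^+ 2 by exact: sqr_ge0.
have t0 : (r * e0 + N) ^+ 2 <= 2 * (N ^+ 2 * W).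
  have h1 : N ^+ 2 * (1 + e0 ^+ 2) <= N ^+ 2 * W by rewrite ler_wpM2l ?hW ?sqr_ge0.
  have h2 : 0 <= (r * e0 - N) ^+ 2 by exact: sqr_ge0.
  nra.
have t1 : (e1 + N - kap * (r * e0)) ^+ 2 <= (3 + 3 * kap ^+ 2) * (N ^+ 2 * W).
  have h1 : N ^+ 2 * (1 + e0 ^+ 2) <= N ^+ 2 * W by rewrite ler_wpM2l ?hW ?sqr_ge0.
  have h2 : N ^+ 2 * (1 + e1 ^+ 2) <= N ^+ 2 * W by rewrite ler_wpM2l ?hW ?sqr_ge0.
  have h3 : kap ^+ 2 * (r ^+ 2 * e0 ^+ 2) <= kap ^+ 2 * (N ^+ 2 * W).
    rewrite ler_wpM2l// (le_trans b0)// ler_wpM2l ?sqr_ge0//.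
    by rewrite (le_trans _ (hW i0))// lerDr.
  have h4 : e1 ^+ 2 <= N ^+ 2 * e1 ^+ 2 by rewrite ler_peMl// sqr_ge0.
  have h5 : (e1 + N - kap * (r * e0)) ^+ 2 <=
      3 * (e1 ^+ 2 + N ^+ 2 + kap ^+ 2 * (r ^+ 2 * e0 ^+ 2)).
    rewrite -subr_ge0 (_ : _ - _ = (e1 - N) ^+ 2 + (e1 + kap * (r * e0)) ^+ 2 +
      (N + kap * (r * e0)) ^+ 2); last by ring.
    by rewrite !addr_ge0// sqr_ge0.
  lra.
have NW : 1 <= N ^+ 2 * W by rewrite mulr_ege1.
rewrite [leRHS](_ : _ = N ^+ 2 * W + (2 * (N ^+ 2 * W) +
  (3 + 3 * kap ^+ 2) * (N ^+ 2 * W) + n%:R * (N ^+ 2 * W))); last by ring.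
by apply: lerD NW _; apply: lerD _ rest; exact: lerD t0 t1.
Qed.

Definition sobolev_const (kap sg N : R) : R :=
  ((6 + 3 * kap ^+ 2 + n%:R) * N ^+ 2) `^ sg.

(** One of the two factors [weight] pays for the growth of the Sobolev weight: for [sg <= 1] the
    power [sg] of its inverse is at most the inverse itself. The other factor keeps the bound
    integrable. *)
Lemma sobolev_weight_bound (N r kap s sg : R) eta : 1 <= N -> 0 < r -> r <= N ->
  s <= sg -> 0 <= sg <= 1 ->
  (1 + enorm (pack N r kap eta) ^+ 2) `^ s * weight eta ^+ 2 <=
  sobolev_const kap sg N * weight eta.
Proof.
move=> N1 r0 rN ssg /andP[sg0 sg1]; have w0 := weight_gt0 eta.
have h := sqr_enorm_pack kap eta N1 r0 rN.
have k2 : 0 <= kap ^+ 2 by exact: sqr_ge0.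
have b1 : 1 <= 1 + enorm (pack N r kap eta) ^+ 2 by rewrite lerDl sqr_ge0.
have cN : 0 <= (6 + 3 * kap ^+ 2 + n%:R) * N ^+ 2.
  by apply: mulr_ge0 (sqr_ge0 _); have := ler0n R n; lra.
have W1 : 1 <= (weight eta)^-1.
  by rewrite (le_trans _ (oneDsqr_le_weightV eta i0))// lerDl sqr_ge0.
rewrite expr2 mulrA ler_pM2r// -ler_pdivlMr//.
rewrite (le_trans (ler_powR b1 ssg))//.
apply: (@le_trans _ _ (((6 + 3 * kap ^+ 2 + n%:R) * N ^+ 2 * (weight eta)^-1) `^ sg)).
  have n1 : 1 + enorm (pack N r kap eta) ^+ 2 \in Num.nneg.
    by rewrite nnegrE (le_trans ler01).
  have n2 : (6 + 3 * kap ^+ 2 + n%:R) * N ^+ 2 * (weight eta)^-1 \in Num.nneg.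
    by rewrite nnegrE mulr_ge0// (le_trans ler01).
  exact: ge0_ler_powR sg0 _ _ n1 n2 h.
rewrite powRM ?invr_ge0 ?(ltW w0)// /sobolev_const ler_wpM2l ?powR_ge0//.
by rewrite -[leRHS]powRr1 ?(le_trans ler01)// ler_powR.
Qed.

Lemma sobolev_norm_packet (N r kap s sg : R) : 1 <= N -> 0 < r -> r <= N ->
  s <= sg -> 0 <= sg <= 1 ->
  (sobolev_norm s (dist_of_fun (@packet R m N r kap)) <=
   (((2 * pi) ^- n * (r * (sobolev_const kap sg N * pi ^+ n))) `^ 2^-1)%:E)%E.
Proof.
move=> N1 r0 rN ssg sg01.
pose F xi := ((1 + enorm xi ^+ 2) `^ s * Normc.normc (packet_hat N r kap xi) ^+ 2)%:E.
have F0 xi : (0 <= F xi)%E.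
  by rewrite lee_fin mulr_ge0 ?powR_ge0// sqr_ge0.
have mF : measurable_fun setT F.
  apply/measurable_EFinP; apply: measurable_funM.
    apply: (measurableT_comp (measurable_powR s)); apply: measurable_funD => //.
    under eq_fun do rewrite sqr_enorm.
    by apply: measurable_sum => i; apply: measurable_funX; exact: measurable_tnth.
  apply: measurable_funX; apply: measurable_normc; exact: packet_hat_measurable.
have hF : (\int[mu]_xi F xi <= (r * (sobolev_const kap sg N * pi ^+ n))%:E)%E.
  rewrite (ge0_integral_pack N kap r0 mF F0) EFinM lee_pmul2l ?lte_fin//.
  rewrite EFinM -integral_weight -ge0_integralZl//; last 3 first.
  - by apply/measurable_EFinP; exact: measurable_weight.
  - by move=> x _; rewrite lee_fin ltW// weight_gt0.
  - by rewrite lee_fin powR_ge0.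
  apply: ge0_le_integral => //.
  - exact: (measurableT_comp mF (measurable_pack N r kap)).
  - apply/measurable_EFinP; apply: measurable_funM => //; exact: measurable_weight.
  - move=> eta _; rewrite -EFinM lee_fin /packet_hat packK// normc_real.
    by rewrite real_normK ?num_real//; exact: sobolev_weight_bound.
have g0 : dist_is_fun (dist_fourier (dist_of_fun (@packet R m N r kap))) (packet_hat N r kap).
  rewrite -(fourier_packet N kap r0); apply: dist_of_fun_fourier.
    exact: packet_integrable.
  by rewrite fourier_packet//; exact: packet_hat_integrable.
apply: (@le_trans _ _ ((((2 * pi) ^- n)%:E * \int[mu]_xi F xi) `^ 2^-1)%E).
  by apply: ereal_inf_lbound; exists (packet_hat N r kap).
have I0 : (0 <= \int[mu]_xi F xi)%E by apply: integral_ge0.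
rewrite -poweR_EFin; apply: gt0_ler_poweR.
- by rewrite invr_ge0.
- by rewrite in_itv/= leey andbT mule_ge0// lee_fin ltW// two_pi_gt0.
- rewrite in_itv/= leey andbT lee_fin.
  apply: mulr_ge0 (ltW two_pi_gt0) (mulr_ge0 (ltW r0) _).
  by apply: mulr_ge0 (powR_ge0 _ _) _; rewrite exprn_ge0// pi_ge0.
- by rewrite EFinM lee_pmul2l ?lte_fin ?two_pi_gt0.
Qed.

End packet_estimates.

(** * The maximal function *)

Section maximal.
Context {R : realType} {n : nat}.
Local Notation C := R[i].
Local Notation E := (n.-tuple (measurableTypeR R)).
Local Notation mu := (@lebesgue_tuple R n).

Lemma measurable_unit_ball : measurable (@unit_ball R n).
Proof.
rewrite (_ : unit_ball = (fun x : E => dotp x x) @^-1` `]-oo, 1%R[%classic).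
  have md : measurable_fun setT (fun x : E => dotp x x).
    apply: measurable_sum => i; apply: measurable_funM; exact: measurable_tnth.
  by rewrite -[X in measurable X]setTI; apply: md => //; exact: measurable_itv.
apply/seteqP; split => x; rewrite /unit_ball /= in_itv/= /enorm.
- by rewrite -[X in _ < X]sqrtr1 ltr_sqrt.
- by move=> x1; rewrite -[X in _ < X]sqrtr1 ltr_sqrt.
Qed.

(** A majorant dominates [u t] outside a null set that depends on [t]. With the times restricted to
    a sequence, the union of these sets is null, and a time chosen depending on [x] becomes
    legitimate. *)
Lemma maximal_L1_ge (u : R -> E -> C) (D : set E) (c : R) (ts : nat -> R) :
  measurable D -> D `<=` unit_ball -> 0 <= c ->
  (forall x, D x -> exists2 j, 0 < ts j < 1 & c <= Normc.normc (u (ts j) x)) ->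
  (c%:E * mu D <= maximal_L1 unit_ball u)%E.
Proof.
move=> mD Dball c0 hD; apply/ereal_infP => _ [F [mF F0 hF ->]].
apply: (@le_trans _ _ (\int[mu]_(x in D) F x)%E); last first.
  apply: ge0_subset_integral => //; first exact: measurable_unit_ball.
  exact: measurable_funTS.
rewrite -integral_cst//; apply: ae_ge0_le_integral => //.
- exact: measurable_funTS.
have : {ae mu, forall x, forall j, 0 < ts j < 1 -> unit_ball x ->
    ((Normc.normc (u (ts j) x))%:E <= F x)%E}.
  apply: ae_foralln => j; case: (boolP (0 < ts j < 1)) => tj.
    by apply: filterS (hF _ tj) => x h _; exact: h.
  by apply: nearW => x.
apply: filterS => x hx Dx; have [j tj cu] := hD x Dx.
by apply: le_trans (hx j tj (Dball _ Dx)); rewrite lee_fin.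
Qed.

Lemma sobolev_norm_ge0 (s : R) (f : (E -> C) -> C) : (0 <= sobolev_norm s f)%E.
Proof. by apply/ereal_infP => _ [g _ ->]; exact: poweR_ge0. Qed.

End maximal.

Section powers.
Context {R : realType}.

Lemma powR_unbounded (K e : R) : 0 < e -> exists2 M : R, 1 <= M & K < M `^ e.
Proof.
move=> e0; have K1 : 1 <= `|K| + 1 by rewrite lerDr.
exists ((`|K| + 1) `^ e^-1).
  by rewrite -[leLHS](powRr0 (`|K| + 1)) ler_powR// invr_ge0 ltW.
rewrite -powRrM mulVf ?gt_eqF// powRr1 ?(le_trans ler01)//.
by rewrite (le_lt_trans (ler_norm K))// ltrDl.
Qed.

End powers.

(** * The region, the grid of times and the choice of scales *)

Section counterexample.
Context {R : realType} {m : nat}.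
Local Notation C := R[i].
Local Notation n := m.+2.
Local Notation E := (n.-tuple (measurableTypeR R)).
Local Notation mu := (@lebesgue_tuple R n).

(** The [i0]-th coordinate is negative and the others positive, so that [x_0 - kap * x_1] is
    negative and the time that cancels the coefficient of [y] is positive. *)
Definition region (rho : R) : set E := [set x | forall i,
  (if i == i0 then `](- (2 * rho)), (- rho)[%classic else `]0, rho[%classic) (tnth x i)].

Lemma measurable_region rho : measurable (region rho).
Proof.
apply: (measurable_forall_tnth (A := fun i : 'I_n =>
  if i == i0 then `](- (2 * rho)), (- rho)[%classic else `]0, rho[%classic)) => i.
by case: ifP => _; exact: measurable_itv.
Qed.

Lemma lebesgue_region rho : 0 < rho -> mu (region rho) = (rho ^+ n)%:E.
Proof.
move=> rho0; rewrite /region (@lebesgue_tuple_box R n (fun i : 'I_n =>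
  if i == i0 then `](- (2 * rho)), (- rho)[%classic else `]0, rho[%classic)).
  rewrite (eq_bigr (fun=> rho%:E)) => [|i _].
    rewrite big_const_ord -[X in _ = (_ ^+ X)%:E]/n.
    by elim: n => //= k ->; rewrite exprS EFinM.
  case: ifP => _; rewrite lebesgue_measure_itv/= lte_fin.
    by rewrite ifT; [rewrite -EFinB; congr EFin; ring|lra].
  by rewrite rho0 oppr0 adde0.
by move=> i; case: ifP => _; exact: measurable_itv.
Qed.

Lemma region_bound rho x i : 0 < rho -> region rho x -> `|tnth x i| <= 2 * rho.
Proof.
move=> rho0 /(_ i); case: ifP => _; rewrite /= in_itv/= => /andP[h1 h2];
  by rewrite ler_norml; apply/andP; split; lra.
Qed.

Lemma region_plane rho x : region rho x ->
  - (2 * rho) < tnth x i0 < - rho /\ 0 < tnth x i1 < rho.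
Proof. by move=> hx; split; [have := hx i0|have := hx i1]; rewrite /= in_itv. Qed.

Lemma region_ball rho : 0 < rho -> rho <= (2 * n%:R)^-1 -> region rho `<=` unit_ball.
Proof.
move=> rho0 rhon x hx; rewrite /unit_ball /= /enorm -[X in _ < X]sqrtr1 ltr_sqrt//.
have n2 : 2 <= n%:R :> R by rewrite ler_nat.
have n0 : 0 < n%:R :> R by lra.
have hr : 2 * rho * n%:R <= 1.
  have n20 : 0 < 2 * n%:R :> R by rewrite mulr_gt0.
  have := ler_wpM2r (ltW n20) rhon; rewrite mulVf ?gt_eqF//; lra.
apply: (@le_lt_trans _ _ (\sum_(i < n) (2 * rho) ^+ 2)).
  apply: ler_sum => i _; rewrite -expr2 -real_normK ?num_real//.
  by rewrite lerXn2r ?nnegrE ?(region_bound i rho0)// mulr_ge0// ltW.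
rewrite sumr_const card_ord -mulr_natr.
have r2 : 2 * rho <= 1 / 2 by nra.
nra.
Qed.

Variables (k : nat) (P : mpoly.mpoly n R) (c1 c2 : R) (Q : mpoly.mpoly m R).
Hypothesis k2 : (2 <= k)%N.
Hypothesis Pk : mpoly.msize P = k.+1.
Hypotheses (c10 : 0 < c1) (c20 : 0 < c2).
Hypothesis PE : homog_part k P =
    c1 *: mvar ord0 ^+ k - c2 *: mvar (lift ord0 ord0) ^+ k + shift2 Q.

Let kap : R := Num.sqrt (c1 / c2).

Let kap0 : 0 < kap. Proof. by rewrite sqrtr_gt0 divr_gt0. Qed.

Let c12 : c1 = c2 * kap ^+ 2.
Proof. by rewrite sqr_sqrtr ?divr_ge0 ?ltW// mulrC divfK// gt_eqF. Qed.

(** For [x] in the region, a grid time just after the cancelling time [t0] keeps the phase within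
    [d] of a constant for all frequencies in the cube, and the evolved packet is then of order [r]
    at [x]. *)
Lemma maximal_packet_lower : exists2 c : R, 0 < c & forall N r : R,
  1 <= r -> r <= N -> k = 2%N \/ r ^+ 3 <= N ^+ 2 ->
  ((c * r)%:E <= maximal_L1 unit_ball (fun t => inv_fourier (fun xi : E =>
     packet_hat N r kap xi * expi (mpoly.meval (tnth xi) P * t))%R))%E.
Proof.
have [d d0 hd] := @cos_ge_half R.
have [L L1 hL] := @weight_concentrates R n.
have KL0 : 0 <= (kap + 1) * L.
  by rewrite mulr_ge0 ?(le_trans ler01 L1)// addr_ge0// ltW.
have [A [A0 Ak] hA] := @binomial_remainder R k _ KL0.
have [K K0 hK] := phase_bound k2 Pk c10 c20 PE kap0 c12 L1 A0 hA.
pose c := k%:R * (c1 + c2 * kap).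
have c0 : 0 < c.
  by rewrite mulr_gt0 ?ltr0n ?(leq_trans _ k2)// addr_gt0// mulr_gt0.
(* The three bounds keep the phase error below [d], the region inside the unit ball, and the times
   below 1. *)
pose rho := Num.min (d / (K + 1)) (Num.min (2 * n%:R)^-1 (c / (4 * (kap + 2)))).
have K10 : 0 < K + 1 by rewrite ltr_wpDl.
have k20 : 0 < kap + 2 by rewrite addr_gt0.
have rho0 : 0 < rho.
  by rewrite !lt_min divr_gt0//= invr_gt0 mulr_gt0//= divr_gt0// mulr_gt0.
have rhod : K * rho <= d.
  apply: (@le_trans _ _ ((K + 1) * rho)); first by rewrite ler_wpM2r ?(ltW rho0)// lerDl.
  by rewrite mulrC -ler_pdivlMr// ge_min lexx.
have rhon : rho <= (2 * n%:R)^-1 by rewrite !ge_min lexx orbT.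
have rhoc : (kap + 2) * rho <= c / 4.
  have : rho <= c / (4 * (kap + 2)) by rewrite !ge_min lexx !orbT.
  by rewrite ler_pdivlMr ?mulr_gt0//; lra.
exists ((2 * pi) ^- n * (pi ^+ n / 8) * rho ^+ n).
  apply: mulr_gt0; last exact: exprn_gt0.
  by apply: mulr_gt0 two_pi_gt0 _; rewrite divr_gt0// exprn_gt0// pi_gt0.
move=> N r r1 rN kN.
have r0 : 0 < r by exact: lt_le_trans r1.
have N1 : 1 <= N by exact: le_trans rN.
have N0 : 0 < N by exact: lt_le_trans N1.
have Nk0 : 0 < N ^+ k.-1 by rewrite exprn_gt0.
have Nk1 : 1 <= N ^+ k.-1 by rewrite exprn_ege1.
have AN : A = 0 \/ r ^+ 3 <= N ^+ 2 by case: kN => [/Ak|]; [left|right].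
(* One step of the grid changes the coefficient of [y] by [c * N ^+ k.-1 * tau = rho / r], which is
   what [phase_bound] tolerates. *)
pose tau := rho / (c * N ^+ k.-1 * r).
have cNr : 0 < c * N ^+ k.-1 * r := mulr_gt0 (mulr_gt0 c0 Nk0) r0.
have tau0 : 0 < tau by rewrite divr_gt0.
pose b := (2 * pi) ^- n * (r * (pi ^+ n / 8)).
rewrite (_ : _ * _ * r = b * rho ^+ n); last by rewrite /b; ring.
rewrite EFinM -lebesgue_region//.
apply: (maximal_L1_ge (ts := fun j => j.+1%:R * tau)).
- exact: measurable_region.
- exact: region_ball.
- apply: mulr_ge0 (ltW two_pi_gt0) _; rewrite mulr_ge0 ?(ltW r0)//.
  by rewrite divr_ge0// exprn_ge0// pi_ge0.
move=> x hx.
have xr i := region_bound i rho0 hx.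
pose X := kap * tnth x i1 - tnth x i0.
have X0 : 0 < X.
  have [/andP[_ h2] /andP[h1 _]] := region_plane hx.
  have := mulr_gt0 kap0 h1; rewrite /X; lra.
have Xrho : X <= (kap + 2) * rho.
  have [/andP[h2 _] /andP[_ h1]] := region_plane hx.
  have : kap * tnth x i1 <= kap * rho by rewrite ler_pM2l// ltW.
  rewrite /X; lra.
pose t0 := X / (c * N ^+ k.-1).
have cN : 0 < c * N ^+ k.-1 := mulr_gt0 c0 Nk0.
have t00 : 0 <= t0 by rewrite divr_ge0// ltW.
have t0X : c * N ^+ k.-1 * t0 = X by rewrite mulrC divfK// gt_eqF.
(* The grid consists of the multiples [j.+1 * tau]; the first one beyond [t0] is positive and
   exceeds [t0] by at most [tau]. *)
pose j := Num.truncn (t0 / tau).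
have /andP[j1 j2] : j%:R <= t0 / tau < j.+1%:R by rewrite truncn_itv// divr_ge0// ltW.
pose t := j.+1%:R * tau.
have tl : t0 < t by rewrite -ltr_pdivrMr.
have tu : t <= t0 + tau.
  by rewrite /t -natr1 mulrDl mul1r lerD2r -ler_pdivlMr.
have t04 : t0 <= 1 / 4.
  rewrite ler_pdivrMr// (le_trans Xrho)// (le_trans rhoc)//.
  have : c <= c * N ^+ k.-1 by rewrite ler_peMr// ltW.
  lra.
have tau4 : tau <= 1 / 4.
  rewrite ler_pdivrMr// mulrC.
  have h1 : c <= c * N ^+ k.-1 * r by rewrite -mulrA ler_peMr ?mulr_ege1// ltW.
  have h2 : rho <= (kap + 2) * rho by have := mulr_gt0 kap0 rho0; lra.
  lra.
exists j; first by rewrite -/t; apply/andP; split; lra.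
apply: (inv_fourier_packet_lower (L := L) (al := t * N ^+ k * (c1 - c2) +
  N * (tnth x i0 + tnth x i1))) => // eta heta.
apply: hd; apply: le_trans rhod.
have rho_ge0 := ltW rho0.
have t_ge0 : 0 <= t by apply: le_trans t00 (ltW tl).
apply: hK => //.
(* The coefficient of [y] is affine in the time and vanishes at [t0]. *)
have -> : tnth x i0 - kap * tnth x i1 + k%:R * (t * N ^+ k.-1) * (c1 + c2 * kap) =
    c * N ^+ k.-1 * (t - t0).
  by rewrite mulrBr t0X /X /c; ring.
rewrite ger0_norm; last by rewrite mulr_ge0 ?(ltW cN)//; lra.
apply: (@le_trans _ _ (c * N ^+ k.-1 * tau * r)).
  by rewrite ler_pM2r// ler_pM2l//; lra.
by rewrite mulrAC /tau mulrC divfK// gt_eqF.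
Qed.

(** With [N = M ^+ 3] and [r = M ^+ p], the condition [r ^+ 3 <= N ^+ 2] reads [p <= 2], and [r = N]
    is [p = 3]. The squared estimate bounds [r] by a multiple of N^(2 sg), so [M] to the power
    [p - 6 sg] stays bounded, which fails for large [M] if [sg < p / 6]. *)
Lemma sobolev_exponent (p : nat) (s : R) : (2 <= p <= 3)%N ->
  k = 2%N \/ p = 2%N -> maximal_estimate P s -> p%:R / 6 <= s.
Proof.
move=> /andP[p2 p3] kp [Cs hCs]; rewrite leNgt; apply/negP => sp.
have p3R : p%:R <= 3 :> R by rewrite (ler_nat R p 3).
have p2R : 2 <= p%:R :> R by rewrite (ler_nat R 2 p).
(* The packet bound needs a nonnegative exponent, and [s] may be negative. *)
pose sg := Num.max s 0.
have sg0 : 0 <= sg by rewrite le_max lexx orbT.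
have ssg : s <= sg by rewrite le_max lexx.
have sgp : sg < p%:R / 6 by rewrite gt_max sp; lra.
have sg01 : 0 <= sg <= 1 by rewrite sg0; lra.
have [c c0 hc] := maximal_packet_lower.
pose C1 := 6 + 3 * kap ^+ 2 + n%:R.
have C10 : 0 <= C1 by have := sqr_ge0 kap; have := ler0n R n; rewrite /C1; lra.
(* What remains of the squared estimate after dividing by [c ^+ 2] and by the powers of [M]. *)
pose D := Cs ^+ 2 * ((2 * pi) ^- n * (C1 `^ sg * pi ^+ n)) / c ^+ 2.
have [M M1 hM] := @powR_unbounded R D (p%:R - 6 * sg) ltac:(lra).
have M0 : 0 < M by exact: lt_le_trans M1.
have r1 : 1 <= M ^+ p by rewrite exprn_ege1.
have rN : M ^+ p <= M ^+ 3 by rewrite ler_weXn2l.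
have N1 : 1 <= M ^+ 3 by rewrite exprn_ege1.
have kN : k = 2%N \/ (M ^+ p) ^+ 3 <= (M ^+ 3) ^+ 2.
  by case: kp => [|->]; [left|right; rewrite -!exprM].
have r0 : 0 < M ^+ p by exact: lt_le_trans r1.
pose G := @packet R m (M ^+ 3) (M ^+ p) kap.
have iG : Cintegrable G by exact: packet_integrable.
have FG : fourier G = packet_hat (M ^+ 3) (M ^+ p) kap by exact: fourier_packet.
have ig : Cintegrable (fourier G) by rewrite FG; exact: packet_hat_integrable.
have hs := @sobolev_norm_packet R m _ _ kap _ _ N1 r0 rN ssg sg01.
have fs : sobolev s (dist_of_fun G).
  by split; [exact: dist_of_fun_tempered|exact: le_lt_trans hs (ltry _)].
have := hCs _ fs _ (fun t _ => dist_of_fun_evolution iG ig P t).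
rewrite FG => /(le_trans (hc _ _ r1 rN kN)).
set B := _ `^ _ in hs.
have := sobolev_norm_ge0 s (dist_of_fun G).
move: hs; rewrite -/G; case: (sobolev_norm _ _) => [X| |] //=.
rewrite !lee_fin => XB X0 hX.
(* The sign of [Cs] is unknown; with its absolute value, the norm [X] can be replaced by its upper
   bound [B]. *)
have {hX XB} hB : c * M ^+ p <= `|Cs| * B.
  rewrite (le_trans hX)// (@le_trans _ _ (`|Cs| * X))//.
    by rewrite ler_wpM2r// ler_norm.
  by rewrite ler_wpM2l.
have pin : 0 <= (pi : R) ^+ n by rewrite exprn_ge0// pi_ge0.
have B2 : B ^+ 2 = (2 * pi) ^- n * (M ^+ p * (@sobolev_const R m kap sg (M ^+ 3) * pi ^+ n)).
  rewrite /B -powR_mulrn ?powR_ge0// -powRrM mulVf// powRr1//.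
  apply: mulr_ge0 (ltW two_pi_gt0) (mulr_ge0 (ltW r0) (mulr_ge0 (powR_ge0 _ _) pin)).
have scE : @sobolev_const R m kap sg (M ^+ 3) = C1 `^ sg * M `^ (6 * sg).
  rewrite /sobolev_const powRM ?sqr_ge0//; congr (_ * _).
  by rewrite -exprM -powR_mulrn ?(ltW M0)// -powRrM.
have {hB} : (c * M ^+ p) ^+ 2 <= (`|Cs| * B) ^+ 2.
  by rewrite lerXn2r ?nnegrE ?mulr_ge0 ?powR_ge0 ?(ltW c0) ?(ltW r0).
rewrite !exprMn B2 scE real_normK ?num_real// => h.
have Mp : M `^ (p%:R - 6 * sg) * M `^ (6 * sg) = M ^+ p.
  by rewrite -powRD ?(gt_eqF M0) ?implybT// subrK powR_mulrn// ltW.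
have q0 : 0 < M `^ (6 * sg) by rewrite powR_gt0.
have : M `^ (p%:R - 6 * sg) <= D.
  rewrite /D ler_pdivlMr ?exprn_gt0// -(ler_pM2r q0) mulrAC Mp -(ler_pM2r r0).
  apply: le_trans (le_trans _ h) _; rewrite le_eqVlt; apply/orP; left; apply/eqP; ring.
by rewrite leNgt hM.
Qed.

End counterexample.

Theorem corollary1p3 (R : realType) (m k : nat) (P : mpoly.mpoly m.+2 R)
    (c1 c2 : R) (Q : mpoly.mpoly m R) (s : R) :
  (2 <= k)%N ->
  mpoly.msize P = k.+1 ->
  0 < c1 -> 0 < c2 ->
  is_form k Q ->
  homog_part k P =
    c1 *: mvar ord0 ^+ k - c2 *: mvar (lift ord0 ord0) ^+ k + shift2 Q ->
  maximal_estimate P s ->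
  (k = 2%N -> 1 / 2 <= s) /\ ((3 <= k)%N -> 1 / 3 <= s).
Proof.
move=> k2 Pk c10 c20 _ PE hP; split=> [k2E|_].
- have := sobolev_exponent k2 Pk c10 c20 PE (p := 3) isT (or_introl k2E) hP; lra.
- have := sobolev_exponent k2 Pk c10 c20 PE (p := 2) isT (or_intror erefl) hP; lra.
Qed.
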